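(* Let $r,k,\ell,n$ be positive integers and let $\lambda$ be a partition of $n$. Then the restriction of $W^\lambda_{\mathcal{A}_{r,k+\ell}(n)}$ to $\bigoplus_{d=0}^r\mathcal{A}_{d,k}(n)\otimes\mathcal{A}_{r-d,\ell}(n)\subseteq\mathcal{A}_{r,k+\ell}(n)$ has the decomposition $$\mathrm{Res}^{\mathcal{A}_{r,k+\ell}(n)}_{\bigoplus_{d=0}^r\mathcal{A}_{d,k}(n)\otimes\mathcal{A}_{r-d,\ell}(n)}W^\lambda_{\mathcal{A}_{r,k+\ell}(n)}\cong\bigoplus_{d=0}^r\ \bigoplus_{\nu\vdash n}\ \bigoplus_{\gamma\vdash n}\left(W^\nu_{\mathcal{A}_{d,k}(n)}\otimes W^\gamma_{\mathcal{A}_{r-d,\ell}(n)}\right)^{\oplus g_{\lambda\nu\gamma}},$$ where $g_{\lambda\nu\gamma}=\dim\mathrm{Hom}_{\mathbb{C}S_n}(W^\lambda_{\mathbb{C}S_n},W^\nu_{\mathbb{C}S_n}\otimes W^\gamma_{\mathbb{C}S_n})$ are the Kronecker coefficients.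
   Context: $\mathcal{P}^s(V_{n,m})$ is the space of homogeneous polynomials of degree $s$ over $\mathbb{C}$ in the commuting variables $x_{ij}$, $1\le i\le n$, $1\le j\le m$ (with $\mathcal{P}^0=\mathbb{C}$). The symmetric group $S_n$ acts by $\sigma\cdot x_{i_1j_1}\cdots x_{i_sj_s}=x_{\sigma(i_1)j_1}\cdots x_{\sigma(i_s)j_s}$. $\mathcal{A}_{s,m}(n)=\mathrm{End}_{\mathbb{C}S_n}(\mathcal{P}^s(V_{n,m}))$. For a partition $\lambda$ of $n$, $W^\lambda_{\mathbb{C}S_n}$ is the irreducible $\mathbb{C}S_n$-module indexed by $\lambda$, and $W^\lambda_{\mathcal{A}_{s,m}(n)}:=\mathrm{Hom}_{\mathbb{C}S_n}(W^\lambda_{\mathbb{C}S_n},\mathcal{P}^s(V_{n,m}))$, an $\mathcal{A}_{s,m}(n)$-module by post-composition (irreducible when non-zero; it may be zero). Tensor products of $\mathbb{C}S_n$-modules carry the diagonal action. **Orbit basis.** Let $[m]=\{1,\dots,m\}$, $[\bar m]=\{\bar1,\dots,\bar m\}$. $\Pi_{s,m,n}$ is the set of multisets of at most $n$ non-empty multisets (blocks) with entries in $[m]\cup[\bar m]$, containing in total $s$ entries from $[m]$ and $s$ from $[\bar m]$. An ordered pair of degree-$s$ monomials $(M,M')$ in the $x_{ij}$ ($i\le n$, $j\le m$) determines an element of $\Pi_{s,m,n}$: for each $i$, the block with colour $i$ contains one $j$ for each factor $x_{ij}$ of $M$ and one $\bar j$ for each factor $x_{ij}$ of $M'$ (empty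 blocks discarded). For $\pi\in\Pi_{s,m,n}$, $O_\pi$ is the operator sending each monomial $M$ to the sum of all monomials $M'$ such that $(M,M')$ determines $\pi$; the $O_\pi$ form a basis of $\mathcal{A}_{s,m}(n)$. **The embedding.** $\mathcal{A}_{d,k}(n)\otimes\mathcal{A}_{r-d,\ell}(n)$ is embedded in $\mathcal{A}_{r,k+\ell}(n)$ by sending $O_\pi\otimes O_\gamma$ ($\pi\in\Pi_{d,k,n}$, $\gamma\in\Pi_{r-d,\ell,n}$) to $\sum_\tau O_\tau$, the sum over all $\tau\in\Pi_{r,k+\ell,n}$ such that the restriction of $\tau$ to entries in $[k]\cup[\bar k]$ is $\pi$, and the restriction of $\tau$ to entries in $\{k+1,\dots,k+\ell\}\cup\{\overline{k+1},\dots,\overline{k+\ell}\}$ becomes $\gamma$ after subtracting $k$ from every entry (barred entries staying barred); restrictions discard empty blocks. The direct sum over $d=0,\dots,r$ of these subalgebras is the subalgebra $\bigoplus_{d=0}^r\mathcal{A}_{d,k}(n)\otimes\mathcal{A}_{r-d,\ell}(n)$. On the right-hand side of the decomposition, the $d$-th summand is a module over the $d$-th component of the algebra, the other components acting by zero. *)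

(* Defs.v *)
From HB Require Import structures.
From mathcomp Require Import all_boot all_order all_algebra all_fingroup.
From mathcomp Require Import mxrepresentation.
From mathcomp Require Import mpoly finmap multiset.
From mathcomp Require Import complex.
From mathcomp Require Import reals.

Set Implicit Arguments.
Unset Strict Implicit.
Unset Printing Implicit Defensive.

Import GRing.Theory.

Local Open Scope ring_scope.

Definition dsum (F : fieldType) (I : finType) (V : I -> lmodType F) : Type :=
  {dffun forall i, V i}.

Section DirectSum.
Context (F : fieldType) (I : finType) (V : I -> lmodType F).

HB.instance Definition _ := Choice.copy (dsum V) {dffun forall i, V i}.

Implicit Types x y z : dsum V.

Definition dsum_zero : dsum V := [ffun i => (0 : V i)].
Definition dsum_add x y : dsum V := [ffun i => x i + y i].
Definition dsum_opp x : dsum V := [ffun i => - x i].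
Definition dsum_scale (a : F) x : dsum V := [ffun i => a *: x i].

Fact dsum_addA : associative dsum_add.
Proof. by move=> x y z; apply/ffunP=> i; rewrite !ffunE addrA. Qed.
Fact dsum_addC : commutative dsum_add.
Proof. by move=> x y; apply/ffunP=> i; rewrite !ffunE addrC. Qed.
Fact dsum_add0 : left_id dsum_zero dsum_add.
Proof. by move=> x; apply/ffunP=> i; rewrite !ffunE add0r. Qed.
Fact dsum_addN : left_inverse dsum_zero dsum_opp dsum_add.
Proof. by move=> x; apply/ffunP=> i; rewrite !ffunE addNr. Qed.

HB.instance Definition _ :=
  GRing.isZmodule.Build (dsum V) dsum_addA dsum_addC dsum_add0 dsum_addN.

Fact dsum_scaleA a b x : dsum_scale a (dsum_scale b x) = dsum_scale (a * b) x.
Proof. by apply/ffunP=> i; rewrite !ffunE scalerA. Qed.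
Fact dsum_scale1 : left_id 1 dsum_scale.
Proof. by move=> x; apply/ffunP=> i; rewrite !ffunE scale1r. Qed.
Fact dsum_scaleDr : right_distributive dsum_scale +%R.
Proof. by move=> a x y; apply/ffunP=> i; rewrite !ffunE scalerDr. Qed.
Fact dsum_scaleDl x : {morph dsum_scale^~ x : a b / a + b}.
Proof. by move=> a b; apply/ffunP=> i; rewrite !ffunE scalerDl. Qed.

HB.instance Definition _ := GRing.Zmodule_isLmodule.Build F (dsum V)
  dsum_scaleA dsum_scale1 dsum_scaleDr dsum_scaleDl.

End DirectSum.

(* An element of the tensor product of U and V is given by its matrix of    *)
(* coordinates on the tensors of the vectors of two chosen bases.           *)
Notation tens U V := 'M_(\dim (fullv : {vspace U}), \dim (fullv : {vspace V})).

Section Tensor.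
Context (F : fieldType) (U V : vectType F).

Definition tensv (u : U) (v : V) : 'M[F]_(\dim {:U}, \dim {:V}) :=
  \matrix_(i, j) (coord (vbasis {:U}) i u * coord (vbasis {:V}) j v).

(* The linear map sending [tensv u v] to [f u v], for a bilinear f.         *)
Definition tens_lift (W : lmodType F) (f : U -> V -> W)
    (t : 'M[F]_(\dim {:U}, \dim {:V})) : W :=
  \sum_i \sum_j t i j *: f (vbasis {:U})`_i (vbasis {:V})`_j.

Fact tens_lift_is_linear (W : lmodType F) (f : U -> V -> W) :
  linear (tens_lift f).
Proof.
move=> a s t; rewrite /tens_lift scaler_sumr -big_split /=; apply: eq_bigr => i _.
rewrite scaler_sumr -big_split /=; apply: eq_bigr => j _.
by rewrite !mxE scalerDl scalerA.
Qed.

HB.instance Definition _ (W : lmodType F) (f : U -> V -> W) :=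
  GRing.isLinear.Build F _ W *:%R (tens_lift f) (tens_lift_is_linear f).

Lemma tensv_vbasis (i : 'I_(\dim {:U})) (j : 'I_(\dim {:V})) :
  tensv (vbasis {:U})`_i (vbasis {:V})`_j = delta_mx i j.
Proof.
apply/matrixP=> i' j'; rewrite !mxE !coord_free ?(basis_free (vbasisP _)) //.
by rewrite -natrM mulnb (eq_sym i') (eq_sym j').
Qed.

Lemma tens_eq (W : vectType F) (f g : 'Hom('M[F]_(\dim {:U}, \dim {:V}), W)) :
  (forall u v, f (tensv u v) = g (tensv u v)) -> f = g.
Proof.
move=> fg; apply/lfunP=> t; rewrite [t]matrix_sum_delta !linear_sum.
apply: eq_bigr => i _; rewrite !linear_sum; apply: eq_bigr => j _.
by rewrite !linearZ -tensv_vbasis /= fg.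
Qed.

Lemma tens_liftE (W : lmodType F) (f : U -> V -> W) u v :
  (forall a u u' v, f (a *: u + u') v = a *: f u v + f u' v) ->
  (forall a u v v', f u (a *: v + v') = a *: f u v + f u v') ->
  tens_lift f (tensv u v) = f u v.
Proof.
move=> fl fr.
pose flL v := GRing.isLinear.Build F U W *:%R (f^~ v) (fun a x y => fl a x y v).
pose frL u := GRing.isLinear.Build F V W *:%R (f u) (fun a x y => fr a u x y).
pose fL v : {linear U -> W} := HB.pack (f^~ v) (flL v).
pose fR u : {linear V -> W} := HB.pack (f u) (frL u).
rewrite -[f u v]/(fL v u) {2}(coord_vbasis (memvf u)) linear_sum.
apply: eq_bigr => i _; rewrite linearZ /=.
rewrite -[f _ v]/(fR _ v) {2}(coord_vbasis (memvf v)) linear_sum scaler_sumr.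
by apply: eq_bigr => j _; rewrite linearZ scalerA mxE.
Qed.

End Tensor.

Section TensorMap.
Context (F : fieldType) (U V U' V' : vectType F).

Definition tens_map (f : 'Hom(U, U')) (g : 'Hom(V, V')) :
    'Hom(tens U V, tens U' V') :=
  linfun (tens_lift (fun u v => tensv (f u) (g v))).

Lemma tens_mapE f g u v : tens_map f g (tensv u v) = tensv (f u) (g v).
Proof.
rewrite lfunE /= tens_liftE // => a *; apply/matrixP=> i j;
by rewrite !mxE !linearP /= ?mulrDl ?mulrDr -?mulrA // mulrCA.
Qed.

End TensorMap.

(* In MathComp (s * t)%g is "s, then t", i.e., the composite t \o s, whence *)
(* the order in [sn_actM] for left modules.                                 *)
Record snModule (F : fieldType) (n : nat) := SnModule {
  sn_sort :> vectType F;
  sn_act : 'S_n -> 'End(sn_sort);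
  sn_act1 : sn_act 1%g = \1%VF;
  sn_actM : forall s t, sn_act (s * t)%g = (sn_act t \o sn_act s)%VF
}.

Section SnHom.
Context (F : fieldType) (n : nat) (U V : snModule F n).

Definition sn_defect (s : 'S_n) (f : 'Hom(U, V)) : 'Hom(U, V) :=
  ((f \o sn_act U s) - (sn_act V s \o f))%VF.

Fact sn_defect_is_linear s : linear (sn_defect s).
Proof.
move=> a f g; apply/lfunP=> u; rewrite !lfun_simp !linearP /=.
by rewrite addrACA -scalerDr.
Qed.
HB.instance Definition _ s :=
  GRing.isLinear.Build F 'Hom(U, V) 'Hom(U, V) *:%R (sn_defect s)
    (sn_defect_is_linear s).

Definition sn_hom : {vspace 'Hom(U, V)} :=
  (\bigcap_(s : 'S_n) lker (linfun (sn_defect s)))%VS.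

Lemma sn_homP (f : 'Hom(U, V)) :
  reflect (forall s u, f (sn_act U s u) = sn_act V s (f u)) (f \in sn_hom).
Proof.
rewrite memvE; apply: (iffP subv_bigcapP) => [h s u | h s _].
  have := h s isT; rewrite -memvE memv_ker lfunE /= subr_eq0.
  by move/eqP/lfunP/(_ u); rewrite !lfunE.
rewrite -memvE memv_ker lfunE /= subr_eq0.
by apply/eqP/lfunP=> u; rewrite !lfunE /= h.
Qed.

End SnHom.

Section SnTensor.
Context (F : fieldType) (n : nat) (U V : snModule F n).

Definition tens_act (s : 'S_n) : 'End(tens U V) :=
  tens_map (sn_act U s) (sn_act V s).

Fact tens_act1 : tens_act 1 = \1%VF.
Proof.
by apply: tens_eq => u v; rewrite /tens_act !sn_act1 tens_mapE !lfunE.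
Qed.

Fact tens_actM s t : tens_act (s * t) = (tens_act t \o tens_act s)%VF.
Proof.
by apply: tens_eq => u v; rewrite comp_lfunE /tens_act !tens_mapE !sn_actM !comp_lfunE.
Qed.

Definition sn_tens : snModule F n := SnModule tens_act1 tens_actM.

End SnTensor.

(* Partitions of n, as nonincreasing sequences padded with zeros to length  *)
(* n.                                                                       *)
Definition is_partition (n : nat) (t : n.-tuple 'I_n.+1) : bool :=
  sorted geq (map val t) && (sumn (map val t) == n).

Definition partition_of (n : nat) : finType :=
  {t : n.-tuple 'I_n.+1 | is_partition t}.

Definition shape_of (n : nat) (la : partition_of n) : seq nat := map val (val la).

Section Specht.
Context (F : fieldType) (n : nat) (la : partition_of n).

(* The rows of the diagram of la are filled, from top to bottom and from    *)
(* left to right, with 0, ..., n.-1; then i lies in row [reshape_index _ i] *)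
(* and in column [reshape_offset _ i].                                      *)
Definition row_stab : {set 'S_n} :=
  [set s : 'S_n | [forall i, reshape_index (shape_of la) (s i)
                             == reshape_index (shape_of la) i]].
Definition col_stab : {set 'S_n} :=
  [set s : 'S_n | [forall i, reshape_offset (shape_of la) (s i)
                             == reshape_offset (shape_of la) i]].

Local Notation Sn := [set: 'S_n]%G.
Local Notation reg := (regular_repr F Sn).

(* The Young symmetrizer, as a vector of the regular module; q * p is the   *)
(* composite p \o q.                                                        *)
Definition young_symmetrizer : 'rV[F]_#|Sn| :=
  gring_row (\sum_(p in row_stab) \sum_(q in col_stab)
               (-1) ^+ q *: reg (q * p)%g).

Definition specht_repr :=
  submod_repr (cyclic_mx_module reg young_symmetrizer).

Definition specht_act (s : 'S_n) :
    'End('rV[F]_(\rank (cyclic_mx reg young_symmetrizer))) :=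
  linfun (mulmxr (specht_repr s)).

Fact specht_act1 : specht_act 1 = \1%VF.
Proof. by apply/lfunP=> u; rewrite !lfunE /= repr_mx1 mulmx1. Qed.

Fact specht_actM s t : specht_act (s * t) = (specht_act t \o specht_act s)%VF.
Proof.
by apply/lfunP=> u; rewrite !lfunE /= !lfunE /= repr_mxM ?inE // mulmxA.
Qed.

Definition specht : snModule F n := SnModule specht_act1 specht_actM.

End Specht.

Definition kronecker (F : fieldType) (n : nat) (la nu ga : partition_of n) : nat :=
  \dim (sn_hom (specht F la) (sn_tens (specht F nu) (specht F ga))).

(* The variable x_ij is 'X_(mxvec_index i j).                               *)

Definition var_perm_fun (n m : nat) (s : 'S_n) (v : 'I_(n * m)) : 'I_(n * m) :=
  let: isMxvecIndex i j := mxvec_indexP v in mxvec_index (s i) j.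

Lemma mxvec_index_inj (n m : nat) (i i' : 'I_n) (j j' : 'I_m) :
  mxvec_index i j = mxvec_index i' j' -> (i, j) = (i', j').
Proof. by move/cast_ord_inj/enum_rank_inj. Qed.

Lemma var_perm_funE (n m : nat) (s : 'S_n) (i : 'I_n) (j : 'I_m) :
  var_perm_fun s (mxvec_index i j) = mxvec_index (s i) j.
Proof.
rewrite /var_perm_fun; move: (erefl (mxvec_index i j)).
move: {2 3}(mxvec_index i j) => v; case: (mxvec_indexP v) => i' j'.
by case/mxvec_index_inj=> -> ->.
Qed.

Fact var_perm_inj (n m : nat) (s : 'S_n) : injective (@var_perm_fun n m s).
Proof.
move=> u v; case/mxvec_indexP: u => i j; case/mxvec_indexP: v => i' j'.
by rewrite !var_perm_funE => /mxvec_index_inj[/perm_inj-> ->].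
Qed.

Definition var_perm (n m : nat) (s : 'S_n) : 'S_(n * m) :=
  perm (@var_perm_inj n m s).

Lemma var_permE (n m : nat) (s : 'S_n) (i : 'I_n) (j : 'I_m) :
  var_perm m s (mxvec_index i j) = mxvec_index (s i) j.
Proof. by rewrite permE var_perm_funE. Qed.

Definition has_degree (N s : nat) (M : 'X_{1..N < s.+1}) : bool := mdeg M == s.

Definition monomial (n m s : nat) : finType :=
  {M : 'X_{1..(n * m) < s.+1} | has_degree M}.

Definition mon_exp (n m s : nat) (M : monomial n m s) : 'X_{1..(n * m)} :=
  bmnm (val M).

Definition hpoly (F : fieldType) (n m s : nat) : Type := dhomog (n * m) F s.

Section HomogeneousPolynomials.
Context (F : fieldType) (n m s : nat).

HB.instance Definition _ := GRing.Lmodule.copy (hpoly F n m s) (dhomog (n * m) F s).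

Implicit Types (p : hpoly F n m s) (M : monomial n m s).

Fact mon_homog M : ('X_[mon_exp M] : {mpoly F[n * m]}) \is s.-homog.
Proof. by rewrite dhomogX; exact: (valP M). Qed.

Definition mon M : hpoly F n m s := DHomog (mon_homog M).

Definition hcoef M p : F := (mpoly_of_dhomog p)@_(mon_exp M).

Lemma mon_exp_inj : injective (@mon_exp n m s).
Proof. by move=> M M' /val_inj/val_inj. Qed.

Lemma hcoef_mon M M' : hcoef M' (mon M) = (M == M')%:R.
Proof. by rewrite /hcoef mcoeffX (inj_eq mon_exp_inj). Qed.

Fact hcoef_is_linear M : scalar (hcoef M).
Proof. by move=> a p q; rewrite /hcoef /= mcoeffD mcoeffZ. Qed.
HB.instance Definition _ M :=
  GRing.isLinear.Build F (hpoly F n m s) F *%R (hcoef M) (hcoef_is_linear M).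

Lemma hpoly_sum p : p = \sum_M hcoef M p *: mon M.
Proof.
apply/val_inj/mpolyP=> e; rewrite /= raddf_sum raddf_sum /=.
have [deg_e | deg_e] := eqVneq (mdeg e) s; last first.
  rewrite (dhomog_nemf_coeff (valP p) deg_e) big1 // => M _.
  rewrite mcoeffZ mcoeffX; case: eqP => [def_e|]; last by rewrite mulr0.
  by move: deg_e; rewrite -def_e (eqP (valP M : mdeg (mon_exp M) == s)) eqxx.
have lt_e : (mdeg e < s.+1)%N by rewrite deg_e.
have hd_e : has_degree (BMultinom lt_e : 'X_{1..(n * m) < s.+1}) by apply/eqP.
pose E : monomial n m s := Sub (BMultinom lt_e) hd_e.
rewrite (bigD1 E) //= mcoeffZ mcoeffX eqxx mulr1 big1 ?addr0 // => M neM.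
by rewrite mcoeffZ mcoeffX (inj_eq mon_exp_inj _ E) (negPf neM) mulr0.
Qed.

Fact hpoly_vecaxiom : vector_axiom #|{: monomial n m s}| (hpoly F n m s).
Proof.
exists (fun p => \row_i hcoef (enum_val i) p) => [a p q|].
  by apply/rowP=> i; rewrite !mxE linearP.
exists (fun r : 'rV_#|{: monomial n m s}| =>
          \sum_M r 0 (enum_rank M) *: mon M) => [p|r].
  rewrite [RHS]hpoly_sum; apply: eq_bigr => M _.
  by rewrite mxE enum_rankK.
apply/rowP=> i; rewrite mxE linear_sum (bigD1 (enum_val i)) //=.
rewrite linearZ /= hcoef_mon eqxx mulr1 enum_valK big1 ?addr0 // => M.
by rewrite linearZ /= hcoef_mon => /negPf->; rewrite mulr0.
Qed.

HB.instance Definition _ :=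
  Lmodule_hasFinDim.Build F (hpoly F n m s) hpoly_vecaxiom.

End HomogeneousPolynomials.

Section PermutationAction.
Context (F : fieldType) (n m s : nat).
Implicit Types (g h : 'S_n) (p : hpoly F n m s).

Fact hperm_homog g p :
  msym (var_perm m g) (mpoly_of_dhomog p) \is s.-homog.
Proof.
apply/dhomogP=> e; rewrite mcoeff_msupp mcoeff_sym -mcoeff_msupp => e_p.
exact: etrans (esym (mdeg_mperm e (var_perm m g))) (dhomog_mf (valP p) e_p).
Qed.

(* The substitution of x_{g(i)j} for x_ij.                                  *)
Definition hperm g p : hpoly F n m s := DHomog (hperm_homog g p).

Fact hperm_is_linear g : linear (hperm g).
Proof. by move=> a p q; apply/val_inj; rewrite /= linearP. Qed.
HB.instance Definition _ g :=
  GRing.isLinear.Build F (hpoly F n m s) (hpoly F n m s) *:%R (hperm g)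
    (hperm_is_linear g).

Definition hpoly_act g : 'End(hpoly F n m s) := linfun (hperm g).

Lemma var_perm1 : var_perm m (1 : 'S_n)%g = 1%g.
Proof. by apply/permP=> v; case/mxvec_indexP: v => i j; rewrite var_permE !perm1. Qed.

Lemma var_permM g h : var_perm m (g * h)%g = (var_perm m g * var_perm m h)%g.
Proof.
by apply/permP=> v; case/mxvec_indexP: v => i j; rewrite permM !var_permE permM.
Qed.

Fact hpoly_act1 : hpoly_act 1 = \1%VF.
Proof. by apply/lfunP=> p; apply/val_inj; rewrite !lfunE /= var_perm1 msym1m. Qed.

Fact hpoly_actM g h : hpoly_act (g * h) = (hpoly_act h \o hpoly_act g)%VF.
Proof.
apply/lfunP=> p; apply/val_inj.
by rewrite comp_lfunE !lfunE /= var_permM msymMm.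
Qed.

(* P^s(V_{n,m})                                                             *)
Definition polyM : snModule F n := SnModule hpoly_act1 hpoly_actM.

End PermutationAction.

(* A_{s,m}(n); its product is [post_comp] below, for U = V.                 *)
Notation alg F n s m := (subvs_of (sn_hom (polyM F n m s) (polyM F n m s))).

(* W^la_{A_{s,m}(n)}                                                        *)
Notation algW F s m la := (subvs_of (sn_hom (specht F la) (polyM F _ m s))).

Section PostComposition.
Context (F : fieldType) (n : nat) (U V : snModule F n).

Fact post_comp_subproof (a : subvs_of (sn_hom V V)) (f : subvs_of (sn_hom U V)) :
  (vsval a \o vsval f)%VF \in sn_hom U V.
Proof.
apply/sn_homP=> s u; rewrite !comp_lfunE (sn_homP _ (subvsP f)).
exact: (sn_homP _ (subvsP a)).
Qed.

Definition post_comp (a : subvs_of (sn_hom V V)) (f : subvs_of (sn_hom U V)) :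
  subvs_of (sn_hom U V) := Subvs (post_comp_subproof a f).

End PostComposition.

(* Multisets with entries in [m] u [mbar], by their multiplicities; inl j   *)
(* is the entry j and inr j is the entry jbar.                              *)
Definition block (m : nat) : choiceType := {ffun 'I_m + 'I_m -> nat}.

Definition empty_block (m : nat) : block m := [ffun=> 0%N].

Definition is_diagram (n s m : nat) (tau : {mset block m}%mset) : bool :=
  [&& (size tau <= n)%N, empty_block m \notin tau,
      (\sum_(B <- tau) \sum_(j < m) B (inl j) == s)%N
    & (\sum_(B <- tau) \sum_(j < m) B (inr j) == s)%N].

Definition nonempty_blocks (m : nat) (bs : seq (block m)) : {mset block m}%mset :=
  seq_mset [seq B <- bs | B != empty_block m].

Section Diagrams.
Context (n s m : nat).
Implicit Types (tau : {mset block m}%mset).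

(* Pi_{s,m,n}                                                               *)
Definition diagram : Type := {tau : {mset block m}%mset | is_diagram n s tau}.

HB.instance Definition _ := Choice.on diagram.

Fact diagram_bound tau B : is_diagram n s tau -> B \in tau ->
  forall e, (B e <= s)%N.
Proof.
case/and4P=> _ _ /eqP s1 /eqP s2 Bin [] j; [rewrite -s1 | rewrite -s2];
by rewrite (big_rem B) //= (bigD1 j) //= -!addnA leq_addr.
Qed.

Local Notation code := {ffun {ffun 'I_m + 'I_m -> 'I_s.+1} -> 'I_n.+1}.

Definition block_of_code (c : {ffun 'I_m + 'I_m -> 'I_s.+1}) : block m :=
  [ffun e => c e : nat].

Definition diagram_code (tau : diagram) : code :=
  [ffun c => inord (val tau (block_of_code c))].

Definition diagram_decode (f : code) : option diagram :=
  insub (seq_mset (flatten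
    [seq nseq (f c) (block_of_code c)
       | c <- enum {: {ffun 'I_m + 'I_m -> 'I_s.+1}}])).

Fact diagram_codeK : pcancel diagram_code diagram_decode.
Proof.
move=> tau; rewrite /diagram_decode.
suff ->: seq_mset (flatten [seq nseq (diagram_code tau c) (block_of_code c)
           | c <- enum {: {ffun 'I_m + 'I_m -> 'I_s.+1}}]) = val tau by exact: valK.
have size_tau : (size (val tau) <= n)%N by case/and4P: (valP tau).
apply/msetP=> B; rewrite mset_seqE count_flatten sumnE 2!big_map big_enum /=.
have E c : count_mem B (nseq (diagram_code tau c) (block_of_code c))
           = ((block_of_code c == B) * val tau B)%N.
  rewrite count_nseq /= ffunE; case: eqP => // ->; rewrite !mul1n inordK //.
  by rewrite ltnS -count_mem_mset (leq_trans (count_size _ _)).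
rewrite (eq_bigr _ (fun c _ => E c)); have [Bin | ] := boolP (B \in val tau).
  pose c0 : {ffun 'I_m + 'I_m -> 'I_s.+1} := [ffun e => inord (B e)].
  have c0E : block_of_code c0 = B.
    apply/ffunP=> e; rewrite !ffunE inordK // ltnS.
    exact: diagram_bound (valP tau) Bin e.
  rewrite (bigD1 c0) //= c0E eqxx mul1n big1 ?addn0 // => c ne.
  case: eqP => // cE; case/negP: ne; apply/eqP/ffunP=> e; apply/val_inj.
  by move/ffunP/(_ e): cE; rewrite -{1}c0E !ffunE.
by rewrite -mset_eq0 => /eqP->; rewrite big1 // => c _; rewrite muln0.
Qed.

HB.instance Definition _ : isCountable diagram := PCanIsCountable diagram_codeK.
HB.instance Definition _ : isFinite diagram := PCanIsFinite diagram_codeK.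

End Diagrams.

Section OrbitBasis.
Context (F : fieldType) (n m s : nat).
Implicit Types (M : monomial n m s) (g : 'S_n) (p : hpoly F n m s).

Definition color_block M M' (i : 'I_n) : block m :=
  [ffun e => match e with
             | inl j => mon_exp M (mxvec_index i j)
             | inr j => mon_exp M' (mxvec_index i j)
             end].

(* The element of Pi_{s,m,n} determined by (M, M').                         *)
Definition pair_diagram M M' : {mset block m}%mset :=
  nonempty_blocks [seq color_block M M' i | i <- enum 'I_n].

Definition orbit_fun (pi : diagram n s m) p : hpoly F n m s :=
  \sum_M hcoef M p *: \sum_(M' | pair_diagram M M' == val pi) mon F M'.

Fact orbit_fun_is_linear pi : linear (orbit_fun pi).
Proof.
move=> a p q; rewrite /orbit_fun scaler_sumr -big_split /=.
by apply: eq_bigr => M _; rewrite linearP /= scalerDl scalerA.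
Qed.
HB.instance Definition _ pi :=
  GRing.isLinear.Build F (hpoly F n m s) (hpoly F n m s) *:%R (orbit_fun pi)
    (orbit_fun_is_linear pi).

Lemma orbit_fun_mon pi M :
  orbit_fun pi (mon F M) = \sum_(M' | pair_diagram M M' == val pi) mon F M'.
Proof.
rewrite /orbit_fun (bigD1 M) //= hcoef_mon eqxx scale1r [X in _ + X]big1 ?addr0 // => M' ne.
by rewrite hcoef_mon eq_sym (negPf ne) scale0r.
Qed.

Definition orbit_end (pi : diagram n s m) : 'End(hpoly F n m s) :=
  linfun (orbit_fun pi).

Fact perm_mon_subproof g M :
  (mdeg [multinom mon_exp M ((var_perm m g)^-1%g v) | v < n * m]%MM < s.+1)%N.
Proof. by rewrite mdeg_mperm ltnS (eqP (valP M : mdeg (mon_exp M) == s)). Qed.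

Fact perm_mon_degree g M : has_degree (BMultinom (perm_mon_subproof g M)).
Proof. by rewrite /has_degree /= mdeg_mperm; exact: valP M. Qed.

Definition perm_mon g M : monomial n m s := Sub _ (perm_mon_degree g M).

Lemma perm_monE g M i j :
  mon_exp (perm_mon g M) (mxvec_index (g i) j) = mon_exp M (mxvec_index i j).
Proof. by rewrite /mon_exp /= mnmE -var_permE permK. Qed.

Lemma hperm_mon g M : hperm g (mon F M) = mon F (perm_mon g M).
Proof. by apply/val_inj; rewrite /= msymX. Qed.

Lemma perm_mon_inj g : injective (perm_mon g).
Proof.
move=> M M' eqM; apply: mon_exp_inj; apply/mnmP=> v.
by case/mxvec_indexP: v => i j; rewrite -(perm_monE g M) -(perm_monE g M') eqM.
Qed.

Lemma pair_diagram_perm g M M' :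
  pair_diagram (perm_mon g M) (perm_mon g M') = pair_diagram M M'.
Proof.
apply/eq_seq_msetP; apply: perm_filter.
have ->: [seq color_block M M' i | i <- enum 'I_n] =
   [seq color_block (perm_mon g M) (perm_mon g M') i | i <- map g (enum 'I_n)].
  rewrite -[RHS]map_comp; apply/eq_in_map => i _; apply/ffunP=> -[] j;
  by rewrite !ffunE perm_monE.
apply/perm_map/uniq_perm; rewrite ?(map_inj_uniq perm_inj) ?enum_uniq //.
move=> i; rewrite mem_enum inE; apply/esym/mapP.
by exists (g^-1%g i); rewrite ?mem_enum // permKV.
Qed.

Lemma hpoly_lfun_eq (V : vectType F) (f h : 'Hom(hpoly F n m s, V)) :
  (forall M, f (mon F M) = h (mon F M)) -> f = h.
Proof.
move=> fh; apply/lfunP=> p; rewrite (hpoly_sum p) !linear_sum.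
by apply: eq_bigr => M _; rewrite !linearZ /= fh.
Qed.

Fact orbit_subproof (pi : diagram n s m) :
  (orbit_end pi : 'Hom(polyM F n m s, polyM F n m s)) \in
    sn_hom (polyM F n m s) (polyM F n m s).
Proof.
apply/sn_homP=> g p; rewrite -!comp_lfunE; congr (fun_of_lfun _ p).
apply: hpoly_lfun_eq => M; rewrite !comp_lfunE !lfunE /=.
rewrite hperm_mon !orbit_fun_mon linear_sum /=.
rewrite (reindex_inj (perm_mon_inj (g := g))) /=.
by apply: eq_big => M'; rewrite ?pair_diagram_perm // hperm_mon.
Qed.

(* O_pi                                                                     *)
Definition orbit_op (pi : diagram n s m) : alg F n s m :=
  Subvs (orbit_subproof pi).

Definition orbit_tuple : #|{: diagram n s m}|.-tuple (alg F n s m) :=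
  [tuple orbit_op (enum_val i) | i < #|{: diagram n s m}|].

Definition orbit_coord (pi : diagram n s m) (a : alg F n s m) : F :=
  coord orbit_tuple (enum_rank pi) a.

Fact block_mon_subproof (bs : seq (block m)) (f : 'I_m -> 'I_m + 'I_m) :
  size bs = n -> (\sum_(B <- bs) \sum_(j < m) B (f j) = s)%N ->
  exists M : monomial n m s, forall i j,
    mon_exp M (mxvec_index i j) = nth (empty_block m) bs i (f j).
Proof.
move=> size_bs sum_bs.
pose A := \matrix_(i < n, j < m) nth (empty_block m) bs i (f j).
pose e := [multinom mxvec A ord0 v | v < n * m]%MM.
have e_ij i j : e (mxvec_index i j) = nth (empty_block m) bs i (f j).
  by rewrite mnmE mxvecE mxE.
have deg_e : mdeg e = s.
  rewrite mdegE (reindex _ (curry_mxvec_bij n m)) /=.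
  rewrite (eq_bigr (fun v => e (mxvec_index v.1 v.2))); last by case.
  rewrite -(pair_bigA _ (fun i j => e (mxvec_index i j))) /= -sum_bs.
  rewrite (big_nth (empty_block m)) big_mkord size_bs.
  by apply: eq_bigr => i _; apply: eq_bigr => j _; exact: e_ij.
have lt_e : (mdeg e < s.+1)%N by rewrite deg_e.
have hd_e : has_degree (BMultinom lt_e) by apply/eqP.
by exists (Sub (BMultinom lt_e) hd_e : monomial n m s).
Qed.

Lemma pair_diagramP (pi : diagram n s m) :
  exists M M', pair_diagram M M' = val pi.
Proof.
have /and4P[le_n ne0 /eqP s1 /eqP s2] := valP pi.
pose bs : seq (block m) := val pi ++ nseq (n - size (val pi)) (empty_block m).
have size_bs : size bs = n by rewrite size_cat size_nseq subnKC.
have sum_bs f : (\sum_(B <- bs) \sum_(j < m) B (f j)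
                 = \sum_(B <- val pi) \sum_(j < m) B (f j))%N.
  rewrite big_cat /= [X in (_ + X)%N]big1_seq ?addn0 // => B /andP[_].
  by rewrite mem_nseq => /andP[_ /eqP->]; rewrite big1 // => j _; rewrite ffunE.
have [M ME] := block_mon_subproof size_bs (etrans (sum_bs inl) s1).
have [M' M'E] := block_mon_subproof size_bs (etrans (sum_bs inr) s2).
exists M, M'; rewrite /pair_diagram /nonempty_blocks -[RHS]seq_mset_id.
congr seq_mset.
have ->: [seq color_block M M' i | i <- enum 'I_n] = bs.
  apply: (@eq_from_nth _ (empty_block m)); rewrite size_map size_enum_ord ?size_bs //.
  move=> i lt_i; rewrite (nth_map (Ordinal lt_i)) ?size_enum_ord //.
  apply/ffunP=> -[] j; rewrite ffunE ?ME ?M'E nth_enum_ord //.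
rewrite filter_cat filter_nseq eqxx cats0; apply/all_filterP/allP=> B Bin.
by apply: contraNneq ne0 => <-.
Qed.

Definition mon_coef M M' (a : alg F n s m) : F := hcoef M' (vsval a (mon F M)).

Fact mon_coef_is_linear M M' : scalar (mon_coef M M').
Proof. by move=> c a b; rewrite /mon_coef linearP add_lfunE scale_lfunE linearP. Qed.
HB.instance Definition _ M M' :=
  GRing.isLinear.Build F (alg F n s m) F *%R (mon_coef M M')
    (mon_coef_is_linear M M').

Lemma mon_coef_orbit pi M M' :
  mon_coef M M' (orbit_op pi) = (pair_diagram M M' == val pi)%:R.
Proof.
rewrite /mon_coef /= lfunE /= orbit_fun_mon linear_sum /=.
under eq_bigr do rewrite hcoef_mon.
have [eq_pi | ne_pi] := boolP (pair_diagram M M' == val pi).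
  rewrite (bigD1 M') //= eqxx big1 ?addr0 // => M1 /andP[_ /negPf].
  by rewrite eq_sym => ->.
by rewrite big1 // => M1 eq_pi; case: eqP => // def; rewrite -def eq_pi in ne_pi.
Qed.

Lemma orbit_tupleE (i : 'I_#|{: diagram n s m}|) :
  orbit_tuple`_i = orbit_op (enum_val i).
Proof. by rewrite -tnth_nth tnth_mktuple. Qed.

Lemma orbit_free : free orbit_tuple.
Proof.
apply/freeP=> c c0 i; have [M [M' MM']] := pair_diagramP (enum_val i).
move/(congr1 (mon_coef M M')): c0; rewrite linear_sum linear0 => <-.
rewrite (bigD1 i) // big1 ?addr0 => [|i' ne];
  rewrite linearZ orbit_tupleE /= mon_coef_orbit MM'.
  by rewrite eqxx mulr1 addr0.
case: eqP => [def_i|_]; last by rewrite mulr0.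
have {}def_i : enum_val i = enum_val i' :> diagram n s m := val_inj def_i.
by rewrite (enum_val_inj def_i) eqxx in ne.
Qed.

Lemma orbit_coordE pi pi' : orbit_coord pi (orbit_op pi') = (pi == pi')%:R.
Proof.
have ->: orbit_op pi' = orbit_tuple`_(enum_rank pi').
  by rewrite orbit_tupleE enum_rankK.
by rewrite /orbit_coord coord_free ?orbit_free // (inj_eq enum_rank_inj) eq_sym.
Qed.

End OrbitBasis.

Definition restrict_block (k m : nat) (h : 'I_k -> 'I_m) (B : block m) : block k :=
  [ffun e => match e with inl j => B (inl (h j)) | inr j => B (inr (h j)) end].

(* The restriction to the entries h j and (h j)bar, renamed to j and jbar.  *)
Definition restrict_diagram (k m : nat) (h : 'I_k -> 'I_m)
    (tau : {mset block m}%mset) : {mset block k}%mset :=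
  nonempty_blocks [seq restrict_block h B | B <- tau].

Section Embedding.
Context (F : fieldType) (n r k l : nat).

Definition embed_orbits (d : nat) (pi : diagram n d k)
    (ga : diagram n (r - d) l) : alg F n r (k + l) :=
  \sum_(tau : diagram n r (k + l) |
          (restrict_diagram (@lshift k l) (val tau) == val pi)
       && (restrict_diagram (@rshift k l) (val tau) == val ga))
     orbit_op F tau.

Definition embed (d : nat) (x : tens (alg F n d k) (alg F n (r - d) l)) :
    alg F n r (k + l) :=
  tens_lift (fun a b => \sum_pi \sum_ga
    (orbit_coord pi a * orbit_coord ga b) *: embed_orbits pi ga) x.

Lemma embed_orbit (d : nat) (pi : diagram n d k) (ga : diagram n (r - d) l) :
  embed (tensv (orbit_op F pi) (orbit_op F ga)) = embed_orbits pi ga.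
Proof.
rewrite /embed tens_liftE => [|c a a' b|c a b b'].
- rewrite (bigD1 pi) //= (bigD1 ga) //= !orbit_coordE !eqxx mulr1 scale1r.
  rewrite !big1 ?addr0 // => [pi' ne|ga' ne].
    by rewrite big1 // => ga' _; rewrite orbit_coordE (negPf ne) mul0r scale0r.
  by rewrite !orbit_coordE (negPf ne) mulr0 scale0r.
- rewrite scaler_sumr -big_split; apply: eq_bigr => pi' _ /=.
  rewrite scaler_sumr -big_split; apply: eq_bigr => ga' _ /=.
  by rewrite /orbit_coord linearP /= mulrDl scalerDl scalerA mulrA.
rewrite scaler_sumr -big_split; apply: eq_bigr => pi' _ /=.
rewrite scaler_sumr -big_split; apply: eq_bigr => ga' _ /=.
by rewrite /orbit_coord linearP /= mulrDr scalerDl scalerA mulrCA.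
Qed.

Definition sum_alg : lmodType F :=
  dsum (fun d : 'I_r.+1 => tens (alg F n d k) (alg F n (r - d) l) : lmodType F).

Definition sum_embed (x : sum_alg) : alg F n r (k + l) :=
  \sum_(d < r.+1) embed (x d).

(* The action of A_{d,k}(n) (x) A_{r-d,l}(n) with a (x) b sending f (x) g   *)
(* to (a f) (x) (b g).                                                      *)
Definition tens_mod_act (d : nat) (nu ga : partition_of n)
    (x : tens (alg F n d k) (alg F n (r - d) l))
    (t : tens (algW F d k nu) (algW F (r - d) l ga)) :
    tens (algW F d k nu) (algW F (r - d) l ga) :=
  tens_lift (fun a b =>
    tens_lift (fun f g => tensv (post_comp a f) (post_comp b g)) t) x.

Variable la : partition_of n.

Definition res_act (x : sum_alg) (w : algW F r (k + l) la) :
    algW F r (k + l) la :=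
  post_comp (sum_embed x) w.

Definition kron_summand (d : nat) (nu ga : partition_of n) : lmodType F :=
  {ffun 'I_(kronecker F la nu ga) ->
     tens (algW F d k nu) (algW F (r - d) l ga)}.

Definition kron_sum : lmodType F :=
  dsum (fun d : 'I_r.+1 =>
    dsum (fun nu : partition_of n =>
      dsum (fun ga : partition_of n => kron_summand d nu ga) : lmodType F)
    : lmodType F).

Definition kron_act (x : sum_alg) (t : kron_sum) : kron_sum :=
  [ffun d => [ffun nu => [ffun ga => [ffun i =>
     tens_mod_act (x d) (t d nu ga i)]]]].

End Embedding.

Definition module_iso (F : fieldType) (A : Type) (V W : lmodType F)
    (actV : A -> V -> V) (actW : A -> W -> W) : Prop :=
  exists2 phi : {linear V -> W}, bijective phi &
    forall a v, phi (actV a v) = actW a (phi v).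

(* Main.v *)
From HB Require Import structures.
Require Import Defs.
From mathcomp Require Import all_boot all_order all_algebra all_fingroup.
From mathcomp Require Import pgroup mxrepresentation.
From mathcomp Require Import mpoly finmap multiset.
From mathcomp Require Import complex reals.

(* Multiplication of polynomials in the x_ij with j <= k by polynomials in    *)
(* the x_ij with j > k is an isomorphism of S_n-modules                       *)
(*   (+)_d P^d(V_{n,k}) (x) P^{r-d}(V_{n,l}) ~ P^r(V_{n,k+l}),                *)
(* and an embedded element a (x) b of degree d acts as a (x) b on the d-th    *)
(* summand and as 0 on the others, as one sees on the orbit bases.  Every     *)
(* S_n-module M is the sum over nu of S^nu (x) Hom(S^nu, M), whence           *)
(*   Hom(S^la, M (x) N) ~ (+)_{nu,ga} Hom(S^la, S^nu (x) S^ga)                *)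
(*                                    (x) Hom(S^nu, M) (x) Hom(S^ga, N);      *)
(* take M = P^d(V_{n,k}) and N = P^{r-d}(V_{n,l}).                            *)
(* The decomposition of M rests on the classification of the irreducible      *)
(* S_n-modules: with a_la the row sum and b_mu the signed column sum,         *)
(* b_mu F[S_n] a_la is zero unless la is dominated by mu, and is spanned by   *)
(* b_la a_la for mu = la; hence Hom(S^la, S^mu) is F if la = mu, and else 0.  *)
(* Thus the Specht modules are irreducible and pairwise non-isomorphic, and   *)
(* there are no other irreducibles because S_n has at most as many conjugacy  *)
(* classes as there are partitions of n.                                      *)

Set Implicit Arguments.
Unset Strict Implicit.
Unset Printing Implicit Defensive.

Import GRing.Theory.

(** * Specht modules *)

(** The isomorphism is explicit. Fix d, let M and N be the polynomial modules of degrees d and r -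
    d, and choose bases f_a of Hom(S^nu, M), g_b of Hom(S^ga, N) and h_i of Hom(S^la, S^nu (x)
    S^ga). The tensor of f_a and g_b in the i-th copy goes to mul o (f_a (x) g_b) o h_i, where mul
    is multiplication of polynomials in disjoint sets of variables ([mul_hom]). Its inverse composes
    a homomorphism with [comul_hom] and with p_a (x) q_b, where p_a and q_b are dual to f_a and g_b,
    and reads off the coordinate on h_i.

    The two maps are inverse to each other by [comul_mul], [comul_mul_neq] and [sum_mul_comul],
    which split P^r into the images of the mul, and by [hom_decomposition], which says that p_a o
    f_b is 1 or 0 and that the f_a o p_a, over all nu, add up to the identity. Equivariance is
    [embed_mul] and [embed_mul_neq]; by [orbit_span] these need checking only on orbit operators,
    where both sides are sums of monomials.

    [hom_decomposition] combines Schur's lemma for Specht modules with their completeness. Schur's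
    lemma comes from the elements b_mu x a_la of the group ring ([sandwich_eq0], [sandwich_line]),
    for a homomorphism is determined by the image of the Young symmetrizer, and that image has this
    form. Completeness ([specht_complete]) is a count of irreducibles against [card_classes_sym]. *)

Section Tableau.
Context (n : nat).
Implicit Types (la mu : partition_of n) (i j : 'I_n).

Definition trow la i := reshape_index (shape_of la) i.
Definition tcol la i := reshape_offset (shape_of la) i.

Lemma size_shape la : size (shape_of la) = n.
Proof. by rewrite size_map size_tuple. Qed.

Lemma sumn_shape la : sumn (shape_of la) = n.
Proof. by case/andP: (valP la) => _ /eqP. Qed.

Lemma shape_noninc la x x' : x <= x' ->
  nth 0 (shape_of la) x' <= nth 0 (shape_of la) x.
Proof.
move=> le_x; case: (ltnP x' n) => [lt_x'|le_n]; last first.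
  by rewrite nth_default // size_shape.
case/andP: (valP la) => sorted_la _.
apply: (sorted_leq_nth (leT := geq)) => //.
- by move=> a b c /= h1 h2; exact: leq_trans h2 h1.
- by move=> a /=.
- by rewrite inE size_shape (leq_ltn_trans le_x).
by rewrite inE size_shape.
Qed.

Lemma tcol_lt_shape la i : tcol la i < nth 0 (shape_of la) (trow la i).
Proof. by rewrite reshape_offsetP ?sumn_shape. Qed.

Lemma shape_le la x : nth 0 (shape_of la) x <= n.
Proof.
case: (ltnP x n) => [lt_x|le_n]; last by rewrite nth_default // size_shape.
rewrite (nth_map ord0) ?size_tuple // -ltnS; exact: ltn_ord.
Qed.

Lemma tcol_lt la i : tcol la i < n.
Proof. exact: leq_trans (tcol_lt_shape la i) (shape_le la _). Qed.

Lemma cell_inj la i j : trow la i = trow la j -> tcol la i = tcol la j -> i = j.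
Proof.
rewrite /trow /tcol => er ec; apply: val_inj => /=.
by rewrite -(reshape_indexK (shape_of la) i) er ec reshape_indexK.
Qed.

Lemma cell_exists la x y : y < nth 0 (shape_of la) x ->
  exists i, trow la i = x /\ tcol la i = y.
Proof.
move=> lt_y; have lt_n : flatten_index (shape_of la) x y < n.
  by rewrite -[X in _ < X](sumn_shape la) flatten_indexP.
by exists (Ordinal lt_n); rewrite /trow /tcol flatten_indexKl // flatten_indexKr.
Qed.

(** The sum of the first k parts of la; the dominance order compares these numbers for all k. *)
Definition rows_below la k := #|[set i | trow la i < k]|.

Lemma column_prefix la k y j : tcol la j = y -> k <= trow la j ->
  k <= #|[set i | (tcol la i == y) && (trow la i < k)]|.
Proof.
move=> cj le_k.
have cell (x : 'I_k) : {i | (trow la i == x) && (tcol la i == y)}.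
  apply: sigW; have [|i [ri ci]] := @cell_exists la x y; last first.
    by exists i; rewrite ri ci !eqxx.
  rewrite -cj; apply: leq_trans (tcol_lt_shape la j) (shape_noninc _ _).
  by rewrite ltnW // (leq_trans (ltn_ord x)).
pose f (x : 'I_k) := sval (cell x).
have fP (x : 'I_k) : trow la (f x) = x /\ tcol la (f x) = y.
  by case/andP: (svalP (cell x)) => /eqP ? /eqP.
have f_inj : injective f.
  by move=> x x' eqf; apply: val_inj; rewrite /= -(fP x).1 -(fP x').1 eqf.
rewrite -[X in X <= _](card_ord k) -(card_imset _ f_inj).
apply/subset_leq_card/subsetP=> _ /imsetP[x _ ->]; rewrite inE.
by rewrite (fP x).1 (fP x).2 eqxx ltn_ord.
Qed.

Lemma card_fibers (P : pred 'I_n) (c : 'I_n -> nat) : (forall i, c i < n) ->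
  #|[set i | P i]| = \sum_(y < n) #|[set i | (c i == y) && P i]|.
Proof.
move=> lt_c; rewrite -sum1_card (partition_big (fun i => Ordinal (lt_c i)) predT) //=.
by apply: eq_bigr => y _; rewrite -sum1_card; apply: eq_bigl => i; rewrite !inE andbC.
Qed.

Section Transversal.
Context (la mu : partition_of n) (g : 'S_n).
Hypothesis cell_g_inj :
  forall i j, trow la i = trow la j -> tcol mu (g i) = tcol mu (g j) -> i = j.

Let A y k := [set i | (tcol mu (g i) == y) && (trow la i < k)].
Let B y k := [set i | (tcol mu i == y) && (trow mu i < k)].

(** If column y of mu goes beyond the first k rows, it has k cells in those rows, while each of the
    first k rows of la contributes at most one element to [A y k]. Otherwise the whole column lies
    in the first k rows, and g embeds [A y k] into [B y k]. *)
Lemma transversal_column y k : #|A y k| <= #|B y k|.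
Proof.
have [/existsP[j /andP[/eqP cj le_k]] | no_j] :=
  boolP [exists j, (tcol mu j == y) && (k <= trow mu j)].
  apply: leq_trans (column_prefix cj le_k).
  (* The case k = 0 is separate because [inord] needs a nonempty target. *)
  case: k le_k {cj} => [|k] _.
    by rewrite leqn0 cards_eq0; apply/eqP/setP=> i; rewrite !inE ltn0 andbF.
  rewrite -[X in _ <= X](card_ord k.+1).
  rewrite -(@card_in_imset _ _ (fun i => inord (trow la i) : 'I_k.+1)) ?max_card //.
  move=> i i'; rewrite !inE => /andP[/eqP ci lti] /andP[/eqP ci' lti'] /(congr1 val).
  by rewrite /= !inordK // => eq_r; apply: cell_g_inj; rewrite // ci ci'.
rewrite -(card_imset _ (@perm_inj _ g)); apply/subset_leq_card/subsetP=> j.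
case/imsetP=> i; rewrite inE => /andP[ci _] ->; rewrite inE ci /= ltnNge.
by apply: contra no_j => le_k; apply/existsP; exists (g i); rewrite ci.
Qed.

Lemma transversal_dominance k : rows_below la k <= rows_below mu k.
Proof.
rewrite /rows_below (card_fibers _ (fun i => tcol_lt mu (g i))).
rewrite (card_fibers _ (tcol_lt mu)).
by apply: leq_sum => y _; exact: transversal_column.
Qed.

(** Equal totals force equality in every column. One more row, that of i, enlarges [A] by i, so the
    column of [g i] in mu must gain a cell in the same row. *)
Lemma transversal_cell :
  (forall k, rows_below la k = rows_below mu k) ->
  forall i, exists j, trow mu j = trow la i /\ tcol mu j = tcol mu (g i).
Proof.
move=> eq_rows i; have eqAB k : #|A (tcol mu (g i)) k| = #|B (tcol mu (g i)) k|.
  have := leqif_sum (I := 'I_n) (P := predT)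
    (fun (y : 'I_n) _ => leqif_eq (transversal_column y k)).
  case=> _; rewrite -(card_fibers _ (fun i => tcol_lt mu (g i))).
  rewrite -(card_fibers _ (tcol_lt mu)) [X in X = _](_ : _ = true); last first.
    exact/eqP/eq_rows.
  by move/esym/forallP/(_ (Ordinal (tcol_lt mu (g i))))/eqP.
have ltA : #|A (tcol mu (g i)) (trow la i)| < #|A (tcol mu (g i)) (trow la i).+1|.
  apply: proper_card; apply/properP; split.
    by apply/subsetP=> j; rewrite !inE => /andP[-> /ltnW].
  by exists i; rewrite !inE eqxx //= ltnn.
rewrite !eqAB in ltA.
have /subsetPn[j] : ~~ (B (tcol mu (g i)) (trow la i).+1
                        \subset B (tcol mu (g i)) (trow la i)).
  by apply: contraL ltA => /subset_leq_card; rewrite leqNgt.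
rewrite !inE => /andP[/eqP cj le_r]; rewrite cj eqxx /= -leqNgt => ge_r.
by exists j; split=> //; apply/eqP; rewrite eqn_leq ge_r -ltnS le_r.
Qed.

End Transversal.

Lemma card_row la x : #|[set i | trow la i == x]| = nth 0 (shape_of la) x.
Proof.
apply/eqP; rewrite eqn_leq; apply/andP; split.
  set m := nth _ _ _; case Em: m => [|m'].
    rewrite leqn0 cards_eq0; apply/eqP/setP=> i; rewrite !inE.
    apply/negP=> /eqP ri; have := tcol_lt_shape la i.
    by rewrite ri -/m Em.
  rewrite -[X in _ <= X](card_ord m'.+1).
  rewrite -(@card_in_imset _ _ (fun i => inord (tcol la i) : 'I_m'.+1)) ?max_card //.
  move=> i i'; rewrite !inE => /eqP ri /eqP ri' /(congr1 val) /=.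
  rewrite !inordK ?ltnS.
  - by apply: cell_inj; rewrite ri ri'.
  - by have := tcol_lt_shape la i'; rewrite ri' -/m Em.
  by have := tcol_lt_shape la i; rewrite ri -/m Em.
have cell (y : 'I_(nth 0 (shape_of la) x)) :
    {i | (trow la i == x) && (tcol la i == y)}.
  apply: sigW; have [//|i [ri ci]] := @cell_exists la x y.
  by exists i; rewrite ri ci !eqxx.
pose f (y : 'I_(nth 0 (shape_of la) x)) := sval (cell y).
have fP (y : 'I_(nth 0 (shape_of la) x)) : trow la (f y) = x /\ tcol la (f y) = y.
  by case/andP: (svalP (cell y)) => /eqP ? /eqP.
have f_inj : injective f.
  by move=> y y' eqf; apply: val_inj; rewrite /= -(fP y).2 -(fP y').2 eqf.
rewrite -[X in X <= _]card_ord -(card_imset _ f_inj).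
apply/subset_leq_card/subsetP=> _ /imsetP[y _ ->]; rewrite inE.
by rewrite (fP y).1 eqxx.
Qed.

Lemma rows_belowS la k :
  rows_below la k.+1 = rows_below la k + nth 0 (shape_of la) k.
Proof.
rewrite -card_row /rows_below -cardsUI.
rewrite [X in _ + #|pred_of_set X|](_ : _ = set0) ?cards0 ?addn0.
  by apply: eq_card => i; rewrite !inE ltnS leq_eqVlt orbC.
by apply/setP=> i; rewrite !inE andbC; case: eqP => // ->; rewrite ltnn.
Qed.

Lemma rows_below_inj la mu :
  (forall k, rows_below la k = rows_below mu k) -> la = mu.
Proof.
move=> eq_rows; apply/val_inj/val_inj/(inj_map val_inj) => /=.
apply: (@eq_from_nth _ 0); first by rewrite !size_map !size_tuple.
move=> k _; apply/eqP; rewrite -(eqn_add2l (rows_below la k)).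
by rewrite -rows_belowS !eq_rows -rows_belowS eqxx.
Qed.

Lemma row_stabP la (s : 'S_n) :
  reflect (forall i, trow la (s i) = trow la i) (s \in row_stab la).
Proof. by rewrite inE; apply: (iffP forallP) => h i; apply/eqP; exact: h. Qed.

Lemma col_stabP la (s : 'S_n) :
  reflect (forall i, tcol la (s i) = tcol la i) (s \in col_stab la).
Proof. by rewrite inE; apply: (iffP forallP) => h i; apply/eqP; exact: h. Qed.

(* von Neumann's combinatorial lemma. *)
Lemma transversal_factor la (g : 'S_n) :
  (forall i j, trow la i = trow la j -> tcol la (g i) = tcol la (g j) -> i = j) ->
  exists p q, [/\ p \in row_stab la, q \in col_stab la & g = (p * q)%g].
Proof.
move=> g_inj; have cell i : {j | (trow la j == trow la i) && (tcol la j == tcol la (g i))}.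
  apply: sigW; have [j [rj cj]] := transversal_cell g_inj (fun=> erefl) i.
  by exists j; rewrite rj cj !eqxx.
pose f i := sval (cell i).
have fP i : trow la (f i) = trow la i /\ tcol la (f i) = tcol la (g i).
  by case/andP: (svalP (cell i)) => /eqP ? /eqP.
have f_inj : injective f.
  move=> i j eqf; have [ri ci] := fP i; have [rj cj] := fP j.
  by apply: g_inj; [rewrite -ri -rj eqf | rewrite -ci -cj eqf].
pose p := perm f_inj; exists p, (p^-1 * g)%g; split; last by rewrite mulKVg.
  by apply/row_stabP=> i; rewrite permE (fP i).1.
apply/col_stabP=> i; rewrite permM -(fP _).2 -[f _](permE f_inj).
by rewrite permKV.
Qed.

End Tableau.

Local Open Scope ring_scope.

(** * Young symmetrizers and homomorphisms between Specht modules *)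

Lemma mulmx_lincomb (F : fieldType) (N : nat) (I : finType) (P : pred I)
    (c : I -> F) (X : I -> 'M[F]_N) (B C : 'M[F]_N) :
  B *m (\sum_(i | P i) c i *: X i) *m C = \sum_(i | P i) c i *: (B *m X i *m C).
Proof.
rewrite mulmx_sumr mulmx_suml; apply: eq_bigr => i _.
by rewrite -scalemxAr -scalemxAl.
Qed.

Section GroupRing.
Context (F : fieldType) (n : nat).
Hypothesis charF : [pchar F] =i pred0.
Implicit Types (la mu : partition_of n) (g s t p q : 'S_n).

Local Notation Sn := [set: 'S_n]%G.
Local Notation reg := (regular_repr F Sn).
Local Notation EG := (enveloping_algebra_mx reg).

Lemma row_stabV la p : p \in row_stab la -> p^-1%g \in row_stab la.
Proof. by move=> pR; apply/row_stabP=> i; rewrite -(row_stabP _ _ pR) permKV. Qed.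

Lemma col_stabV la p : p \in col_stab la -> p^-1%g \in col_stab la.
Proof. by move=> pC; apply/col_stabP=> i; rewrite -(col_stabP _ _ pC) permKV. Qed.

(** The factors a and b of the Young symmetrizer. Products read from left to right and group
    elements act on row vectors from the right, so the generator is b a. *)
Definition row_sum la := \sum_(p in row_stab la) reg p.
Definition col_sum la := \sum_(q in col_stab la) (-1) ^+ q *: reg q.

Lemma young_symmetrizerE la :
  young_symmetrizer F la = gring_row (col_sum la *m row_sum la).
Proof.
rewrite /young_symmetrizer; congr gring_row.
rewrite /col_sum mulmx_suml exchange_big /=; apply: eq_bigr => q _.
rewrite /row_sum mulmx_sumr; apply: eq_bigr => p _.
by rewrite -scalemxAl repr_mxM ?inE.
Qed.

Lemma row_sumMl la p : p \in row_stab la -> reg p *m row_sum la = row_sum la.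
Proof.
move=> pR; rewrite /row_sum mulmx_sumr [RHS](reindex_inj (mulgI p)) /=.
apply: eq_big => [s | s _]; last by rewrite repr_mxM ?inE.
apply/idP/idP=> /row_stabP h; apply/row_stabP=> i.
  by rewrite permM h (row_stabP _ _ pR).
have := h (p^-1%g i); rewrite permM permKV => ->.
  by rewrite (row_stabP _ _ (row_stabV pR)).
Qed.

Lemma row_sumMr la p : p \in row_stab la -> row_sum la *m reg p = row_sum la.
Proof.
move=> pR; rewrite /row_sum mulmx_suml [RHS](reindex_inj (mulIg p)) /=.
apply: eq_big => [s | s _]; last by rewrite repr_mxM ?inE.
apply/idP/idP=> /row_stabP h; apply/row_stabP=> i.
  by rewrite permM (row_stabP _ _ pR).
by have := h i; rewrite permM (row_stabP _ _ pR).
Qed.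

Lemma col_sumMr la q : q \in col_stab la ->
  col_sum la *m reg q = (-1) ^+ q *: col_sum la.
Proof.
move=> qC; rewrite /col_sum mulmx_suml scaler_sumr [RHS](reindex_inj (mulIg q)) /=.
apply: eq_big => [s | s _]; last first.
  rewrite -scalemxAl -repr_mxM ?inE // scalerA odd_permM signr_addb mulrA.
  by rewrite mulrAC -signr_addb addbb mul1r.
apply/idP/idP=> /col_stabP h; apply/col_stabP=> i.
  by rewrite permM (col_stabP _ _ qC).
by have := h i; rewrite permM (col_stabP _ _ qC).
Qed.

(** If distinct i, j violated this, the transposition t = (i j) would be absorbed by the row sum,
    while g t = t' g with t' a transposition in the column stabilizer of mu. Then b g a = - b g a,
    which is zero in characteristic 0. *)
Lemma sandwich_transversal la mu g : col_sum mu *m reg g *m row_sum la != 0 ->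
  forall i j, trow la i = trow la j ->
    tcol mu (g^-1%g i) = tcol mu (g^-1%g j) -> i = j.
Proof.
move=> nz i j eq_r eq_c; apply: contraNeq nz => ne_ij.
have tR : tperm i j \in row_stab la.
  by apply/row_stabP=> x; case: tpermP => // ->.
have tC : tperm (g^-1%g i) (g^-1%g j) \in col_stab mu.
  by apply/col_stabP=> x; case: tpermP => // ->.
set X := _ *m _; have : X = - X.
  rewrite {1}/X -(row_sumMl tR) mulmxA -[_ *m _ *m reg (tperm i j)]mulmxA.
  rewrite -repr_mxM ?inE //.
  have -> : (g * tperm i j = tperm (g^-1 i) (g^-1 j) * g)%g.
    by rewrite -tpermJ conjgE invgK !mulgA mulgKV.
  rewrite repr_mxM ?inE // mulmxA col_sumMr // odd_tperm (inj_eq perm_inj) ne_ij.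
  by rewrite expr1 scaleN1r !mulNmx.
move/eqP; rewrite -addr_eq0 -mulr2n -scaler_nat scaler_eq0 => /orP[|//].
by rewrite ((pcharf0P F).1 charF 2).
Qed.

Lemma sandwich_eq0 la mu A : (A \in EG)%MS ->
  ~ (forall k, (rows_below la k <= rows_below mu k)%N) ->
  col_sum mu *m A *m row_sum la = 0.
Proof.
case/envelop_mxP=> c -> no_dom; rewrite mulmx_lincomb big1 // => g _; apply/eqP.
rewrite scaler_eq0; apply/orP; right.
apply/negP=> nz; case: no_dom => k.
by apply: (@transversal_dominance _ la mu g^-1%g); apply: sandwich_transversal; apply/negP.
Qed.

(** A group element g with nonzero contribution has g^-1 = p q by [transversal_factor]; in g = q^-1
    p^-1 the outer sums absorb both factors, up to the sign of q. *)
Lemma sandwich_line la A : (A \in EG)%MS ->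
  exists c, col_sum la *m A *m row_sum la = c *: (col_sum la *m row_sum la).
Proof.
case/envelop_mxP=> c ->; have step g : exists d,
    col_sum la *m reg g *m row_sum la = d *: (col_sum la *m row_sum la).
  have [->|nz] := eqVneq (col_sum la *m reg g *m row_sum la) 0.
    by exists 0; rewrite scale0r.
  have [p [q [pR qC gE]]] := transversal_factor (sandwich_transversal nz).
  exists ((-1) ^+ q); rewrite -[g]invgK gE invMg repr_mxM ?inE // mulmxA.
  by rewrite col_sumMr ?col_stabV // odd_permV -!scalemxAl -mulmxA row_sumMl ?row_stabV.
have [d dE] := fin_all_exists step; exists (\sum_g c g * d g).
rewrite mulmx_lincomb scaler_suml; apply: eq_big => [g|g _].
  by rewrite inE.
by rewrite dE scalerA.
Qed.

(** The coefficient of the identity is 1: if q p = 1 then q lies in both stabilizers, and only the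
    identity preserves the row and the column of every entry. *)
Lemma young_symmetrizer_neq0 la : young_symmetrizer F la != 0.
Proof.
have id_in s : (forall i, trow la (s i) = trow la i) ->
    (forall i, tcol la (s i) = tcol la i) -> s = 1%g.
  by move=> hr hc; apply/permP=> i; rewrite perm1; apply: cell_inj.
suff E : gring_proj (G := Sn) 1%g (col_sum la *m row_sum la) = 1.
  rewrite young_symmetrizerE; apply: contra_eq_neq E => u0.
  by rewrite /gring_proj /= u0 trmx0 row0 eq_sym oner_neq0.
rewrite /col_sum mulmx_suml linear_sum /= (bigD1 1%g) /=; last first.
  by apply/col_stabP=> i; rewrite perm1.
rewrite odd_perm1 expr0 scale1r repr_mx1 mul1mx linear_sum /=.
rewrite (bigD1 1%g) /=; last by apply/row_stabP=> i; rewrite perm1.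
rewrite gring_projE ?inE // eqxx big1 => [|p /andP[_ ne1]]; last first.
  by rewrite gring_projE ?inE // eq_sym (negPf ne1).
rewrite addr0 big1 ?addr0 // => q /andP[qC ne1].
rewrite mulmx_sumr linear_sum big1 //= => p pR.
rewrite -scalemxAl -repr_mxM ?inE // linearZ /= gring_projE ?inE //.
case: eqP => [qp1|_]; last by rewrite scaler0.
case/eqP: ne1; have qE : q = p^-1%g by apply/eqP; rewrite eq_mulgV1 invgK -qp1.
apply: id_in => i; last exact: (col_stabP _ _ qC).
by rewrite qE (row_stabP _ _ (row_stabV pR)).
Qed.

Local Notation U la := (cyclic_mx reg (young_symmetrizer F la)).
Local Notation gen la := (in_submod (U la) (young_symmetrizer F la)).
Local Notation S la := (specht_repr F la).

Lemma specht_gen la v :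
  exists c : 'S_n -> F, v = gen la *m (\sum_g c g *: S la g).
Proof.
have /cyclic_mxP[A /envelop_mxP[c ->] vE] := val_submodP v.
exists c; rewrite -[v]val_submodK vE !mulmx_sumr linear_sum /=.
apply: eq_big => [g|g _]; first by rewrite inE.
rewrite -2!scalemxAr linearZ; congr (_ *: _).
by apply: (in_submodJ (cyclic_mx_module reg _)); rewrite ?inE ?cyclic_mx_id.
Qed.

Lemma young_symmetrizer_row la p : p \in row_stab la ->
  young_symmetrizer F la *m reg p = young_symmetrizer F la.
Proof.
by move=> pR; rewrite young_symmetrizerE -gring_row_mul -mulmxA row_sumMr.
Qed.

Section Hom.
Context (la mu : partition_of n) (f : 'M[F]_(\rank (U la), \rank (U mu))).
Hypothesis f_hom : forall g, S la g *m f = f *m S mu g.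

(* The image of the generator is fixed by the row stabilizer of la, hence   *)
(* lies in [col_sum mu * EG * row_sum la].                                  *)
Lemma specht_hom_gen : exists2 A, (A \in EG)%MS &
  val_submod (gen la *m f) = gring_row (col_sum mu *m A *m row_sum la).
Proof.
set w := val_submod _.
have /cyclic_mxP[A EA wE] : (w <= U mu)%MS by exact: val_submodP.
pose m : F := #|row_stab la|%:R.
have m0 : m != 0.
  rewrite ((pcharf0P F).1 charF) -lt0n; apply/card_gt0P; exists 1%g.
  by apply/row_stabP=> i; rewrite perm1.
have Erow : (row_sum mu \in EG)%MS.
  by rewrite linear_sum; apply: summx_sub => p _; rewrite envelop_mx_id ?inE.
exists (m^-1 *: (row_sum mu *m A)).
  by rewrite linearZ scalemx_sub // envelop_mxM.
have -> : gring_row (col_sum mu *m (m^-1 *: (row_sum mu *m A)) *m row_sum la)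
           = m^-1 *: (young_symmetrizer F mu *m A *m row_sum la).
  by rewrite -scalemxAr -scalemxAl mulmxA young_symmetrizerE -!gring_row_mul linearZ.
rewrite -wE.
suff -> : w *m row_sum la = m *: w by rewrite scalerA mulVf // scale1r.
rewrite /row_sum mulmx_sumr scaler_nat -sumr_const; apply: eq_bigr => p pR.
rewrite /w -val_submodJ ?inE ?cyclic_mx_module // => modU.
by rewrite -mulmxA -[submod_mx modU p]/(S mu p) -f_hom mulmxA -in_submodJ ?cyclic_mx_id //
  young_symmetrizer_row.
Qed.

Lemma specht_hom_gen_inj : gen la *m f = 0 -> f = 0.
Proof.
move=> f0; apply/row_matrixP=> i; rewrite rowE row0.
have [c ->] := specht_gen (delta_mx 0 i).
suff E : (\sum_g c g *: S la g) *m f = f *m (\sum_g c g *: S mu g).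
  by rewrite -mulmxA E mulmxA f0 mul0mx.
rewrite mulmx_suml mulmx_sumr; apply: eq_bigr => g _.
by rewrite -scalemxAl -scalemxAr f_hom.
Qed.

Lemma specht_hom_dominance :
  f != 0 -> forall k, (rows_below la k <= rows_below mu k)%N.
Proof.
have [A EA fE] := specht_hom_gen; move=> nz k; rewrite leqNgt; apply/negP=> ltk.
case/eqP: nz; apply/specht_hom_gen_inj/val_submod_inj; rewrite fE linear0.
rewrite sandwich_eq0 ?linear0 // => /(_ k); by rewrite leqNgt ltk.
Qed.

End Hom.

(** By [sandwich_line] the generator is sent to c times itself, so f - c kills it and is zero. *)
Lemma specht_end_scalar la (f : 'M[F]_(\rank (U la))) :
  (forall g, S la g *m f = f *m S la g) -> exists c, f = c%:M.
Proof.
move=> f_hom; have [A EA fE] := specht_hom_gen f_hom.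
have [c cE] := sandwich_line la EA; exists c; apply/eqP; rewrite -subr_eq0; apply/eqP.
apply: specht_hom_gen_inj => [g|].
  by rewrite mulmxBr mulmxBl f_hom scalar_mxC.
apply/val_submod_inj; rewrite mulmxBr linearB /= fE cE mul_mx_scalar !linearZ /=.
by rewrite -young_symmetrizerE in_submodK ?cyclic_mx_id // scalerN subrr linear0.
Qed.

Lemma specht_rank_gt0 la : (0 < \rank (U la))%N.
Proof. by rewrite lt0n mxrank_eq0 cyclic_mx_eq0 young_symmetrizer_neq0. Qed.

Lemma specht_pchar_group : ([pchar F]^'.-group Sn)%g.
Proof. by rewrite /pgroup pcharf'_nat ((pcharf0P F).1 charF) -lt0n cardG_gt0. Qed.

(** Take a Maschke complement W of a nonzero submodule V. The projection onto V along W is an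
    endomorphism, hence a scalar; it fixes V, so it is 1, and W = 0. *)
Lemma specht_irr la : mx_irreducible (S la).
Proof.
apply/mx_irrP; split=> [|V modV nzV]; first exact: specht_rank_gt0.
have [W modW defVW dxVW] := mx_Maschke_pchar (S la) specht_pchar_group modV (submx1 V).
have dx : (V :&: W = 0)%MS by apply/mxdirect_addsP.
have [c cE] : exists c, proj_mx V W = c%:M.
  apply: specht_end_scalar => g.
  have /hom_mxP/(_ g) : (1%:M <= dom_hom_mx (S la) (proj_mx V W))%MS.
    by rewrite -defVW proj_mx_hom.
  by rewrite !mul1mx; apply; rewrite inE.
have Vc : V *m c%:M = V by rewrite -cE proj_mx_id ?submx_refl.
have {}Vc : c = 1.
  apply/eqP; rewrite -subr_eq0; move/eqP: Vc; rewrite mul_mx_scalar -subr_eq0.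
  by rewrite -{2}[V]scale1r -scalerBl scaler_eq0 (negPf nzV) orbF.
have W0 : W = 0 by rewrite -(proj_mx_0 dx (submx_refl W)) cE Vc mulmx1.
by rewrite -sub1mx -defVW W0 addsmx0_id submx_refl.
Qed.

Lemma specht_rsim_inj la mu : mx_rsim (S la) (S mu) -> la = mu.
Proof.
move=> rs; have dom la1 mu1 : mx_rsim (S la1) (S mu1) ->
    forall k, (rows_below la1 k <= rows_below mu1 k)%N.
  case=> f _ free_f f_hom; apply: (@specht_hom_dominance _ _ f) => [g|].
    by rewrite f_hom ?inE.
  apply: contraTneq free_f => ->; rewrite /row_free mxrank0 eq_sym -lt0n.
  exact: specht_rank_gt0.
apply: rows_below_inj => k; apply/eqP; rewrite eqn_leq.
by rewrite (dom _ _ rs) (dom _ _ (mx_rsim_sym rs)).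
Qed.

End GroupRing.

(** * Conjugacy classes of the symmetric group *)

Section Conjugacy.
Local Open Scope nat_scope.
Context (T : finType).
Implicit Types (s t : {perm T}).

Definition cycle_sizes s := [seq #|pred_of_set C| | C <- enum (porbits s)].

(** The permutation of indices behind [perm_eq] gives h. This matches cycles of equal length below
    and, in [pair_diagram_orbit], colours with equal blocks. *)
Lemma value_matching (I : finType) (K : eqType) (A B : {set I}) (f g : I -> K) :
  perm_eq [seq f x | x <- enum A] [seq g x | x <- enum B] ->
  exists h : I -> I, [/\ {in A, forall x, h x \in B}, {in A &, injective h}
                       & {in A, forall x, g (h x) = f x}].
Proof.
move=> eqAB; have [-> | [x0 _]] := set_0Vmem A.
  by exists id; split=> x; rewrite inE.
have szAB : size (enum A) = size (enum B).
  by rewrite -(size_map f) (perm_size eqAB) size_map.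
have /(perm_iotaP (f x0))[js js_perm eq_js] := eqAB.
rewrite size_map in js_perm.
have sz_js : size js = size (enum A) by rewrite (perm_size js_perm) size_iota szAB.
have js_lt i : i < size (enum A) -> nth 0 js i < size (enum B).
  move=> lt_i; have : nth 0 js i \in js by rewrite mem_nth ?sz_js.
  by rewrite (perm_mem js_perm) mem_iota add0n.
exists (fun x => nth x0 (enum B) (nth 0 js (index x (enum A)))); split.
- by move=> x Ax; rewrite -mem_enum mem_nth // js_lt // index_mem mem_enum.
- move=> x y Ax Ay /eqP; rewrite nth_uniq ?enum_uniq ?js_lt ?index_mem ?mem_enum //.
  rewrite nth_uniq ?sz_js ?index_mem ?mem_enum //; last first.
    by rewrite (perm_uniq js_perm) iota_uniq.
  by move/eqP/(congr1 (nth x0 (enum A))); rewrite !nth_index ?mem_enum.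
move=> x Ax; have lt_i : index x (enum A) < size (enum A) by rewrite index_mem mem_enum.
rewrite -(nth_map x0 (f x0) g) ?js_lt // -(nth_map 0 (f x0)) ?sz_js // -eq_js.
by rewrite (nth_map x0) // nth_index ?mem_enum.
Qed.

Lemma porbit_iter_inj s x i j : i < #|porbit s x| -> j < #|porbit s x| ->
  iter i s x = iter j s x -> i = j.
Proof.
move=> lt_i lt_j; rewrite -(nth_traject s lt_i) -(nth_traject s lt_j) => /eqP.
by rewrite nth_uniq ?size_traject ?uniq_traject_porbit // => /eqP.
Qed.

Lemma iter_porbit_mod s x i : iter (i %% #|porbit s x|) s x = iter i s x.
Proof.
rewrite {2}(divn_eq i #|porbit s x|) addnC iterD; congr (iter _ _ _).
by elim: (i %/ _) => //= k IHk; rewrite mulSn iterD -IHk iter_porbit.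
Qed.

Lemma porbit_iter_transfer s t x y i j : #|porbit s x| = #|porbit t y| ->
  (iter i s x == iter j s x) = (iter i t y == iter j t y).
Proof.
move=> eq_card; have modP (u : {perm T}) z : (iter i u z == iter j u z)
    = (i %% #|porbit u z| == j %% #|porbit u z|).
  rewrite -(iter_porbit_mod u z i) -(iter_porbit_mod u z j).
  apply/eqP/eqP=> [|-> //]; apply: porbit_iter_inj;
  by rewrite ltn_mod lt0n card_porbit_neq0.
by rewrite !modP eq_card.
Qed.

(** Pair each cycle of s with a cycle of t of the same length and choose a base point in each. The
    map sending the k-th iterate of the first base point to the k-th iterate of the second is a
    permutation conjugating s to t. *)
Lemma conjugate_cycle_sizes s t :
  perm_eq (cycle_sizes s) (cycle_sizes t) -> t \in (s ^: [set: {perm T}])%g.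
Proof.
case/value_matching=> h [hB h_inj h_size].
(* Here x is only a default value: for nonempty C the choice depends on C alone ([base_eq]), so all
   points of a cycle share a base point. *)
pose base (C : {set T}) x := odflt x [pick y in C].
have baseP C x : C != set0 -> base C x \in C.
  by case/set0Pn=> y yC; rewrite /base; case: pickP => [//|/(_ y)]; rewrite yC.
have base_eq C x y : C != set0 -> base C x = base C y.
  by case/set0Pn=> z zC; rewrite /base; case: pickP => [//|/(_ z)]; rewrite zC.
have nz u x : porbit u x != set0 by apply/set0Pn; exists x; exact: porbit_id.
have Cs x : porbit s x \in porbits s by exact: imset_f.
pose a x := base (porbit s x) x; pose b x := base (h (porbit s x)) x.
have aE x : porbit s (a x) = porbit s x.
  by apply/eqP; rewrite eq_porbit_mem; apply: baseP.
have hne x : h (porbit s x) != set0.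
  by case/imsetP: (hB _ (Cs x)) => y _ ->; exact: nz.
have bE x : porbit t (b x) = h (porbit s x).
  have := baseP _ x (hne x); rewrite -/(b x).
  by case/imsetP: (hB _ (Cs x)) => y _ -> by_; apply/eqP; rewrite eq_porbit_mem.
have idx x : {i | x == iter i s (a x)}.
  apply: sigW; have : x \in porbit s (a x) by rewrite aE porbit_id.
  by case/porbitP=> i xE; exists i; rewrite -permX -xE.
have [k kE] : {k : T -> nat | forall x, x = iter (k x) s (a x)}.
  by exists (fun x => sval (idx x)) => x; exact/eqP/(svalP (idx x)).
pose phi x := iter (k x) t (b x).
have card_ab x : #|porbit s (a x)| = #|porbit t (b x)|.
  by rewrite aE bE h_size.
have phi_porbit x : porbit t (phi x) = h (porbit s x).
  by rewrite /phi -permX porbit_perm bE.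
have aC x y : porbit s x = porbit s y -> a x = a y.
  by rewrite /a => ->; exact: base_eq.
have bC x y : porbit s x = porbit s y -> b x = b y.
  by rewrite /b => ->; exact: base_eq.
have phi_inj : injective phi.
  move=> x y eq_phi; have eqC : porbit s x = porbit s y.
    by apply: h_inj => //; rewrite -!phi_porbit eq_phi.
  rewrite (kE x) (kE y) -(aC _ _ eqC).
  apply/eqP; rewrite (porbit_iter_transfer _ _ (card_ab x)).
  by move/eqP: eq_phi; rewrite /phi -(bC _ _ eqC).
have phi_s x : phi (s x) = t (phi x).
  have eqC : porbit s (s x) = porbit s x by exact: (porbit_perm s 1).
  rewrite /phi -iterS (bC _ _ eqC); apply/eqP.
  rewrite -(porbit_iter_transfer _ _ (card_ab x)) iterS.
  by rewrite -kE -(aC _ _ eqC) -kE.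
apply/imsetP; exists (perm phi_inj); rewrite ?inE //; apply/permP=> x.
have [y ->] : exists y, x = perm phi_inj y.
  by exists ((perm phi_inj)^-1%g x); rewrite permKV.
by rewrite permJ !permE phi_s.
Qed.

Lemma sumn_cycle_sizes s : sumn (cycle_sizes s) = #|T|.
Proof.
rewrite sumnE big_map big_enum /=.
rewrite -[in RHS]cardsT.
have /card_partition -> // : partition (porbits s) [set: T].
apply/and3P; split.
- apply/eqP/setP=> x; rewrite inE; apply/bigcupP; exists (porbit s x).
    exact: imset_f.
  exact: porbit_id.
- apply/trivIsetP=> _ _ /imsetP[x _ ->] /imsetP[y _ ->].
  apply: contraR; rewrite -setI_eq0 => /set0Pn[z /setIP[zx zy]].
  by apply/eqP; rewrite -!eq_porbit_mem in zx zy; rewrite -(eqP zx) -(eqP zy).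
by apply/imsetP=> -[x _ /setP/(_ x)]; rewrite porbit_id inE.
Qed.

End Conjugacy.

Section CycleType.
Local Open Scope nat_scope.
Context (n : nat).
Implicit Types (s t : 'S_n).

Definition cycle_type_seq s :=
  let c := sort geq (cycle_sizes s) in c ++ nseq (n - size c) 0.

Lemma size_cycle_sizes s : size (cycle_sizes s) <= n.
Proof.
rewrite size_map -cardE; apply: leq_trans (leq_imset_card _ _) _.
by rewrite card_ord.
Qed.

Lemma size_cycle_type s : size (cycle_type_seq s) == n.
Proof. by rewrite size_cat size_nseq size_sort subnKC // size_cycle_sizes. Qed.

Lemma sumn_cycle_type s : sumn (cycle_type_seq s) = n.
Proof.
rewrite sumn_cat sumn_nseq mul0n addn0 (perm_sumn (permEl (perm_sort _ _))).
by rewrite sumn_cycle_sizes card_ord.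
Qed.

Lemma sorted_cycle_type s : sorted geq (cycle_type_seq s).
Proof.
have tr : transitive geq by move=> a b c /= h1 h2; exact: leq_trans h2 h1.
rewrite sorted_pairwise // pairwise_cat -!sorted_pairwise //.
rewrite sort_sorted ?andTb; last by move=> a b; rewrite /= leq_total.
apply/andP; split; last by elim: (n - _) => // -[|k].
by apply/allrelP=> a b _; rewrite mem_nseq => /andP[_ /eqP ->].
Qed.

Definition cycle_type_tuple s : n.-tuple 'I_n.+1 :=
  Tuple (introT eqP (etrans (size_map (fun k => inord k) _)
                            (eqP (size_cycle_type s)))).

Lemma val_cycle_type s : map val (cycle_type_tuple s) = cycle_type_seq s.
Proof.
rewrite /= -map_comp map_id_in // => k kin /=; rewrite inordK // ltnS.
rewrite -[X in _ <= X](sumn_cycle_type s); case/splitPr: kin => c1 c2.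
by rewrite sumn_cat /= addnCA leq_addr.
Qed.

Fact cycle_type_is_partition s : is_partition (cycle_type_tuple s).
Proof.
by rewrite /is_partition val_cycle_type sorted_cycle_type sumn_cycle_type eqxx.
Qed.

Definition cycle_type s : partition_of n := Sub _ (cycle_type_is_partition s).

Lemma cycle_type_conjugate s t :
  cycle_type s = cycle_type t -> t \in (s ^: [set: 'S_n])%g.
Proof.
move/(congr1 (fun la => shape_of la)); rewrite /shape_of !val_cycle_type => eq_st.
(* No cycle is empty, so the zeros are exactly the padding. *)
have sizesE u : perm_eq (cycle_sizes u) [seq k <- cycle_type_seq u | k != 0].
  rewrite filter_cat filter_nseq /= cats0 perm_sym.
  rewrite (all_filterP _) ?perm_sort //; apply/allP=> k.
  rewrite mem_sort => /mapP[C]; rewrite mem_enum => /imsetP[x _ ->] ->.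
  exact: card_porbit_neq0.
apply: conjugate_cycle_sizes; apply: perm_trans (sizesE s) _.
by rewrite eq_st perm_sym.
Qed.

Lemma card_classes_sym : #|classes [set: 'S_n]%g| <= #|partition_of n|.
Proof.
rewrite -(@card_in_imset _ _ (fun C => cycle_type (repr C))) ?max_card //.
move=> C D /(repr_classesP (G := [set: 'S_n]%G))[_ CE].
move=> /(repr_classesP (G := [set: 'S_n]%G))[_ DE] /cycle_type_conjugate.
by move/class_eqP=> eq_cl; rewrite CE DE eq_cl.
Qed.

End CycleType.

(** * Decomposition of modules over the symmetric group *)

(** Specht modules have pairwise distinct irreducible types. Over a closed field there are as many
    types as conjugacy classes, hence at most as many as partitions, so the injection from
    partitions to types is onto. *)
Lemma specht_complete (F : closedFieldType) (n m : nat)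
    (rG : mx_representation F [set: 'S_n]%G m) :
  [pchar F] =i pred0 -> mx_irreducible rG ->
  exists la, mx_rsim (specht_repr F la) rG.
Proof.
move=> charF irrG; pose sG : irrType F [set: 'S_n]%G := DecSocleType _.
have pG := specht_pchar_group n charF.
have splitG := @group_closure_closed_field F _ [set: 'S_n]%G.
pose phi la := irr_comp sG (specht_repr F la).
have rsim_phi la : mx_rsim (specht_repr F la) (irr_repr (phi la)).
  exact: rsim_irr_comp_pchar pG _ _ (specht_irr charF la).
have phi_inj : injective phi.
  move=> la mu eq_phi; apply: (specht_rsim_inj charF).
  by apply: mx_rsim_trans (mx_rsim_sym (rsim_phi mu)); rewrite -eq_phi.
have le_card : (#|{: sG}| <= #|{: partition_of n}|)%N.
  by rewrite (card_irr_pchar sG pG splitG); exact: card_classes_sym.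
have /codomP[la la_rG] := inj_card_onto phi_inj le_card (irr_comp sG rG).
exists la; apply: mx_rsim_trans (rsim_phi la) (mx_rsim_sym _).
by rewrite -la_rG; exact: rsim_irr_comp_pchar pG _ _ irrG.
Qed.

Section Averaging.
Context (F : fieldType) (n : nat).
Hypothesis charF : [pchar F] =i pred0.
Implicit Types U V W : snModule F n.

Lemma sn_actKV U (s : 'S_n) u : sn_act U s^-1%g (sn_act U s u) = u.
Proof. by rewrite -comp_lfunE -sn_actM mulgV sn_act1 lfunE. Qed.

Lemma sn_hom_comp U V W (f : 'Hom(U, V)) (g : 'Hom(V, W)) :
  f \in sn_hom U V -> g \in sn_hom V W -> (g \o f)%VF \in sn_hom U W.
Proof.
move=> /sn_homP f_hom /sn_homP g_hom; apply/sn_homP=> s u.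
by rewrite !comp_lfunE f_hom g_hom.
Qed.

Lemma sn_hom_id U : \1%VF \in sn_hom U U.
Proof. by apply/sn_homP=> s u; rewrite !id_lfunE. Qed.

(* Average over the group of any pseudo-inverse. *)
Lemma sn_hom_pinv U V (h : 'Hom(U, V)) : h \in sn_hom U V ->
  exists2 p, p \in sn_hom V U & (h \o p \o h = h)%VF.
Proof.
move=> /sn_homP h_hom; pose N : F := #|'S_n|%:R.
have N0 : N != 0.
  by rewrite ((pcharf0P F).1 charF) -lt0n; apply/card_gt0P; exists 1%g.
pose p := N^-1 *: \sum_(s : 'S_n) (sn_act U s^-1%g \o h^-1 \o sn_act V s)%VF.
have pE v : p v = N^-1 *: \sum_(s : 'S_n) sn_act U s^-1%g (h^-1%VF (sn_act V s v)).
  rewrite scale_lfunE sum_lfunE; congr (_ *: _).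
  by apply: eq_bigr => s _; rewrite !comp_lfunE.
exists p.
  apply/sn_homP=> t v; rewrite !pE linearZ /=; congr (_ *: _); rewrite linear_sum.
  rewrite (reindex_inj (mulgI t^-1%g)) /=; apply: eq_bigr => s _.
  by rewrite sn_actM invMg invgK sn_actM !comp_lfunE sn_actKV.
apply/lfunP=> u; rewrite !comp_lfunE pE linearZ /= [h (\sum_s _)]linear_sum /=.
rewrite (eq_bigr (fun=> h u)) => [|s _].
  by rewrite sumr_const -scaler_nat scalerA mulVf ?scale1r.
rewrite -h_hom h_hom; have := limg_lfunVK (f := h) (memv_img h (memvf (sn_act U s u))).
by rewrite h_hom => ->; rewrite sn_actKV.
Qed.

End Averaging.

Section Schur.
Context (F : fieldType) (n : nat).
Hypothesis charF : [pchar F] =i pred0.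
Implicit Types la mu : partition_of n.

Lemma specht_actE la g u : sn_act (specht F la) g u = u *m specht_repr F la g.
Proof. by rewrite lfunE. Qed.

Lemma specht_hom_mx la mu (f : 'Hom(specht F la, specht F mu)) :
  f \in sn_hom _ _ ->
  forall g, specht_repr F la g *m lin1_mx f = lin1_mx f *m specht_repr F mu g.
Proof.
move/sn_homP=> f_hom g; apply/row_matrixP=> i; rewrite !rowE [LHS]mulmxA [RHS]mulmxA.
rewrite !mul_rV_lin1; have := f_hom g (delta_mx 0 i).
by rewrite !specht_actE.
Qed.

Lemma specht_hom_eq0 la mu (f : 'Hom(specht F la, specht F mu)) :
  (lin1_mx f == 0) = (f == 0).
Proof.
apply/eqP/eqP=> [f0|->]; last by apply/matrixP=> i j; rewrite !mxE zero_lfunE mxE.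
by apply/lfunP=> u; rewrite zero_lfunE -[f u](mul_rV_lin1 f) f0 mulmx0.
Qed.

(** A nonzero homomorphism has a nonzero equivariant pseudo-inverse in the other direction, so
    dominance holds both ways. *)
Lemma specht_schur_neq la mu (f : 'Hom(specht F la, specht F mu)) :
  f \in sn_hom _ _ -> la != mu -> f = 0.
Proof.
move=> f_hom; apply: contra_neq_eq => nz.
have [p p_hom fpf] := sn_hom_pinv charF f_hom.
have p_nz : p != 0.
  by apply: contra_neq nz => p0; rewrite -fpf p0 comp_lfun0r comp_lfun0l.
apply: rows_below_inj => k; apply/eqP; rewrite eqn_leq.
rewrite (specht_hom_dominance charF (specht_hom_mx f_hom)) ?specht_hom_eq0 //=.
by rewrite (specht_hom_dominance charF (specht_hom_mx p_hom)) ?specht_hom_eq0.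
Qed.

Lemma specht_schur la (f : 'End(specht F la)) :
  f \in sn_hom _ _ -> exists c, f = c *: \1%VF.
Proof.
move=> f_hom; have [c cE] := specht_end_scalar charF (specht_hom_mx f_hom).
exists c; apply/lfunP=> u; rewrite scale_lfunE id_lfunE -[f u](mul_rV_lin1 f) cE.
by rewrite mul_mx_scalar.
Qed.

Lemma specht_id_neq0 la : \1%VF != 0 :> 'End(specht F la).
Proof.
apply/eqP=> /lfunP id0; have := specht_rank_gt0 F la => r_gt0.
have := id0 (const_mx 1); rewrite id_lfunE zero_lfunE.
move/rowP/(_ (Ordinal r_gt0)); rewrite !mxE; exact/eqP/oner_neq0.
Qed.

End Schur.

Section Completeness.
Import VectorInternalTheory.
Context (F : closedFieldType) (n : nat).
Hypothesis charF : [pchar F] =i pred0.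
Context (M : snModule F n).

Definition sn_mx (g : 'S_n) := lin1_mx (v2r \o sn_act M g \o r2v).

Fact sn_mx_repr : mx_repr [set: 'S_n]%G sn_mx.
Proof.
split=> [|g h _ _]; apply/row_matrixP=> i; rewrite !rowE ?mulmxA !mul_rV_lin1 /=.
  by rewrite sn_act1 id_lfunE r2vK mulmx1.
by rewrite v2rK sn_actM comp_lfunE.
Qed.
Canonical sn_mx_representation := MxRepresentation sn_mx_repr.

(** The image of e contains a simple submodule, a copy of some S^la; let h embed S^la there. With p
    an equivariant pseudo-inverse of e, the map f = p h satisfies e f = h because h lands in the
    image of e. *)
Lemma sn_hom_specht_neq0 (e : 'End(M)) : e \in sn_hom M M -> e != 0 ->
  exists la (f : 'Hom(specht F la, M)),
    f \in sn_hom (specht F la) M /\ (e \o f)%VF != 0.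
Proof.
move=> e_hom nz_e; pose E := lin1_mx (v2r \o e \o r2v).
have EE u : u *m E = v2r (e (r2v u)) by rewrite mul_rV_lin1.
have nz_E : E != 0.
  apply: contra_neq nz_e => E0; apply/lfunP=> v; rewrite zero_lfunE.
  by apply: (can_inj v2rK); rewrite linear0 -{1}[v]v2rK -EE E0 mulmx0.
have modE : mxmodule sn_mx_representation <<E>>%MS.
  apply/mxmoduleP=> g _; rewrite (eqmxMr _ (genmxE _)) genmxE.
  apply/row_subP=> i; rewrite rowE mulmxA EE mul_rV_lin1 /= v2rK.
  rewrite -(sn_homP _ e_hom) -[sn_act _ _ _]v2rK -EE; exact: submxMl.
have nz_gE : <<E>>%MS != 0 by rewrite (eqmx_eq0 (genmxE _)).
have [V simV sVE] := dec_mxsimple_exists modE nz_gE.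
have [modV _ _] := simV.
have [la [B _ free_B B_hom]] := specht_complete charF ((submod_mx_irr modV).2 simV).
pose X := B *m val_submod 1%:M.
have X_hom g : specht_repr F la g *m X = X *m sn_mx g.
  rewrite /X mulmxA B_hom ?inE // -[LHS]mulmxA -[RHS]mulmxA; congr (B *m _).
  have := val_submodJ modV 1%:M (in_setT g).
  by rewrite mul1mx [in X in X -> _]val_submodE.
pose h : 'Hom(specht F la, M) := linfun (r2v \o mulmxr X).
have hE u : h u = r2v (u *m X) by rewrite lfunE.
have h_hom : h \in sn_hom (specht F la) M.
  apply/sn_homP=> g u; rewrite !hE specht_actE -mulmxA X_hom mulmxA mul_rV_lin1 /=.
  by rewrite v2rK.
have [p p_hom epe] := sn_hom_pinv charF e_hom.
exists la, (p \o h)%VF; split; first exact: sn_hom_comp p_hom.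
have -> : (e \o (p \o h))%VF = h.
  apply/lfunP=> u; rewrite !comp_lfunE.
  have /submxP[w wE] : (u *m X <= E)%MS.
    rewrite /X mulmxA mulmx_sub // -(genmxE E) (submx_trans _ sVE) //.
    exact: val_submodP.
  by rewrite hE wE EE v2rK -!comp_lfunE epe.
apply/eqP=> h0; have := specht_rank_gt0 F la => r_gt0.
have X0 : X = 0.
  apply/row_matrixP=> i; rewrite rowE row0; apply: (can_inj r2vK).
  by rewrite -hE h0 zero_lfunE linear0.
have B0 : B = 0.
  by apply: (val_submod_inj (U := V)); rewrite linear0 val_submodE.
by move: free_B; rewrite B0 /row_free mxrank0 eq_sym -leqn0 leqNgt r_gt0.
Qed.

End Completeness.

Section LfunSums.
Context (F : fieldType) (U V W : vectType F).

Lemma comp_lfun_suml (I : finType) (f : I -> 'Hom(V, W)) (g : 'Hom(U, V)) :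
  ((\sum_i f i) \o g)%VF = \sum_i (f i \o g)%VF.
Proof.
apply/lfunP=> u; rewrite comp_lfunE !sum_lfunE.
by apply: eq_bigr => i _; rewrite comp_lfunE.
Qed.

Lemma comp_lfun_sumr (I : finType) (f : 'Hom(V, W)) (g : I -> 'Hom(U, V)) :
  (f \o (\sum_i g i))%VF = \sum_i (f \o g i)%VF.
Proof.
apply/lfunP=> u; rewrite comp_lfunE !sum_lfunE linear_sum.
by apply: eq_bigr => i _; rewrite comp_lfunE.
Qed.

End LfunSums.

Section Decomposition.
Context (F : closedFieldType) (n : nat).
Hypothesis charF : [pchar F] =i pred0.

Definition sn_scalar (la : partition_of n) (f : 'End(specht F la)) : F :=
  coord [tuple \1%VF] ord0 f.

Lemma sn_scalarZ la c : sn_scalar (c *: \1%VF : 'End(specht F la)) = c.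
Proof.
have fr : free [tuple \1%VF : 'End(specht F la)] by rewrite seq1_free specht_id_neq0.
by rewrite /sn_scalar linearZ /= -[X in coord _ _ X]/([tuple \1%VF]`_(ord0 : 'I_1))
  coord_free // eqxx mulr1.
Qed.

Lemma sn_scalarE la (f : 'End(specht F la)) : f \in sn_hom _ _ ->
  f = sn_scalar f *: \1%VF.
Proof. by case/(specht_schur charF)=> c ->; rewrite sn_scalarZ. Qed.

Context (M : snModule F n).

Local Notation homM la := (subvs_of (sn_hom (specht F la) M)).

Definition hom_basis la (j : 'I_(\dim {:homM la})) : 'Hom(specht F la, M) :=
  vsval (vbasis {:homM la})`_j.

Lemma hom_basisP la j : @hom_basis la j \in sn_hom (specht F la) M.
Proof. exact: subvsP. Qed.

Lemma hom_basis_span la (f : 'Hom(specht F la, M)) : f \in sn_hom _ _ ->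
  exists c : 'I_(\dim {:homM la}) -> F, f = \sum_j c j *: hom_basis j.
Proof.
move=> f_hom; exists (fun j => coord (vbasis {:homM la}) j (Subvs f_hom)).
rewrite -[LHS]/(vsval (Subvs f_hom)) {1}(coord_vbasis (memvf (Subvs f_hom))).
by rewrite linear_sum; apply: eq_bigr => j _; rewrite linearZ.
Qed.

Lemma hom_basis_free la (c : 'I_(\dim {:homM la}) -> F) :
  \sum_j c j *: hom_basis j = 0 -> forall j, c j = 0.
Proof.
move=> c0; have /freeP := basis_free (vbasisP {:homM la}); apply.
apply: subvs_inj; rewrite linear0 -[RHS]c0 linear_sum.
by apply: eq_bigr => j _; rewrite linearZ.
Qed.

(** Composition pairs Hom(M, S^la) with Hom(S^la, M), with values in End(S^la) = F. For nonzero f a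
    pseudo-inverse p has p f nonzero, so the Gram matrix [G] has independent rows; the columns of a
    right inverse give the dual maps. *)
Lemma hom_dual_exists la :
  exists p : 'I_(\dim {:homM la}) -> 'Hom(M, specht F la),
    (forall j, p j \in sn_hom M (specht F la)) /\
    (forall j k, (p j \o hom_basis k)%VF = (j == k)%:R *: \1%VF).
Proof.
pose b := vbasis (sn_hom M (specht F la)).
have bP a : b`_a \in sn_hom M (specht F la).
  have [lt_a|ge_a] := ltnP a (size b); first exact/vbasis_mem/mem_nth.
  by rewrite nth_default // mem0v.
pose G := \matrix_(k < \dim {:homM la}, a < \dim (sn_hom M (specht F la)))
            sn_scalar (b`_a \o hom_basis k)%VF.
have bG (a : 'I_(\dim (sn_hom M (specht F la)))) k : (b`_a \o hom_basis k)%VF = G k a *: \1%VF.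
  by rewrite mxE -sn_scalarE // sn_hom_comp ?hom_basisP.
have freeG : row_free G.
  apply: inj_row_free => v vG; pose f := \sum_k v 0 k *: hom_basis k.
  have f_hom : f \in sn_hom (specht F la) M.
    by apply: memv_suml => k _; rewrite memvZ // hom_basisP.
  have [p p_hom fpf] := sn_hom_pinv charF f_hom.
  suff f0 : f = 0 by apply/rowP=> k; rewrite mxE; exact: hom_basis_free f0 k.
  suff pf0 : (p \o f)%VF = 0 by rewrite -fpf -comp_lfunA pf0 comp_lfun0r.
  rewrite (coord_vbasis p_hom) comp_lfun_suml big1 // => a _.
  rewrite -comp_lfunZl comp_lfun_sumr (eq_bigr (fun k => v 0 k * G k a *: \1%VF)).
    have := congr1 (fun w : 'rV_ _ => w 0 a) vG; rewrite !mxE => vGa.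
    by rewrite -scaler_suml vGa scale0r scaler0.
  by move=> k _; rewrite -comp_lfunZr bG scalerA.
have /row_freeP[L GL] := freeG; exists (fun j => \sum_a L a j *: b`_a); split=> [j|j k].
  by apply: memv_suml => a _; rewrite memvZ.
rewrite comp_lfun_suml (eq_bigr (fun a => G k a * L a j *: \1%VF)).
  have := congr1 (fun A : 'M_ _ => A k j) GL; rewrite !mxE => GLkj.
  by rewrite -scaler_suml GLkj eq_sym.
by move=> a _; rewrite -comp_lfunZl bG scalerA mulrC.
Qed.

(** The sum X of all f_j p_j fixes every homomorphism from a Specht module into M, so X - 1 kills
    them all; by [sn_hom_specht_neq0] it is zero. *)
Lemma hom_decomposition :
  exists p : forall la, 'I_(\dim {:homM la}) -> 'Hom(M, specht F la),
    [/\ forall la j, p la j \in sn_hom M (specht F la),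
        forall la j k, (p la j \o hom_basis k)%VF = (j == k)%:R *: \1%VF,
        forall la mu j (f : 'Hom(specht F mu, M)), f \in sn_hom _ _ ->
          la != mu -> (p la j \o f)%VF = 0
      & \sum_la \sum_j (hom_basis j \o p la j)%VF = \1%VF].
Proof.
have [p /all_and2[p_hom p_dual]] := fin_all_exists hom_dual_exists; exists p.
have p0 la mu j (f : 'Hom(specht F mu, M)) : f \in sn_hom _ _ ->
    la != mu -> (p la j \o f)%VF = 0.
  move=> f_hom ne; apply: (specht_schur_neq charF); last by rewrite eq_sym.
  exact: sn_hom_comp f_hom (p_hom _ _).
split=> //; apply/eqP; rewrite -subr_eq0; apply: contraT => nz_e.
set X := \sum_la _ in nz_e.
have X_hom : X - \1%VF \in sn_hom M M.
  rewrite rpredB ?sn_hom_id //; apply: memv_suml => la _; apply: memv_suml => j _.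
  exact: sn_hom_comp (p_hom _ _) (hom_basisP _).
have [la [f [f_hom]]] := sn_hom_specht_neq0 charF X_hom nz_e.
have [c ->] := hom_basis_span f_hom; case/eqP.
rewrite comp_lfun_sumr big1 // => k _; rewrite -comp_lfunZr.
suff Xk : (X \o hom_basis k)%VF = hom_basis k.
  by rewrite comp_lfunDl comp_lfunNl Xk comp_lfun1l subrr scaler0.
rewrite comp_lfun_suml (bigD1 la) //= [X in _ + X]big1 ?addr0 => [|mu ne_mu].
  rewrite comp_lfun_suml (bigD1 k) //= -comp_lfunA p_dual eqxx scale1r.
  rewrite comp_lfun1r big1 ?addr0 // => j ne_j.
  by rewrite -comp_lfunA p_dual (negPf ne_j) scale0r comp_lfun0r.
rewrite comp_lfun_suml; apply: big1 => j _.
by rewrite -comp_lfunA p0 ?hom_basisP // comp_lfun0r.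
Qed.

End Decomposition.

(** * Tensor products *)

Section TensorLinear.
Context (F : fieldType) (U V : vectType F).

Lemma tensv_sum (I J : finType) (c : I -> F) (d : J -> F) (u : I -> U) (v : J -> V) :
  tensv (\sum_i c i *: u i) (\sum_j d j *: v j)
  = \sum_i \sum_j (c i * d j) *: tensv (u i) (v j).
Proof.
apply/matrixP=> x y; rewrite mxE summxE !linear_sum mulr_suml /=.
apply: eq_bigr => i _; rewrite summxE mulr_sumr; apply: eq_bigr => j _.
by rewrite !linearZ /= !mxE mulrACA.
Qed.

Lemma tens_ind (P : tens U V -> Prop) :
  (forall a s t, P s -> P t -> P (a *: s + t)) ->
  (forall u v, P (tensv u v)) -> forall t, P t.
Proof.
move=> PD Pv t; have P0 : P 0.
  suff <- : tensv 0 0 = 0 :> tens U V by exact: Pv.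
  by apply/matrixP=> i j; rewrite !mxE linear0 mul0r.
rewrite [t]matrix_sum_delta; elim/big_ind: _ => // [s s' Ps Ps'|i _].
  by rewrite -[s]scale1r; exact: PD.
elim/big_ind: _ => // [s s' Ps Ps'|j _].
  by rewrite -[s]scale1r; exact: PD.
by rewrite -[_ *: _]addr0; apply: PD => //; rewrite -tensv_vbasis.
Qed.

End TensorLinear.

Section TensorLift.
Context (F : fieldType) (U V : vectType F).

Lemma eq_tens_lift (W : lmodType F) (f g : U -> V -> W) (t : 'M[F]_(\dim {:U}, \dim {:V})) :
  (forall u v, f u v = g u v) -> tens_lift f t = tens_lift g t.
Proof.
by move=> fg; apply: eq_bigr => i _; apply: eq_bigr => j _; rewrite fg.
Qed.

Lemma linear_tens_lift (W W' : lmodType F) (h : {linear W -> W'})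
    (f : U -> V -> W) (t : 'M[F]_(\dim {:U}, \dim {:V})) :
  h (tens_lift f t) = tens_lift (fun u v => h (f u v)) t.
Proof.
rewrite linear_sum; apply: eq_bigr => i _; rewrite linear_sum.
by apply: eq_bigr => j _; rewrite linearZ.
Qed.

Lemma comp_tens_liftl (X Y Z : vectType F) (f : U -> V -> 'Hom(Y, Z))
    (h : 'Hom(X, Y)) (t : 'M[F]_(\dim {:U}, \dim {:V})) :
  (tens_lift f t \o h)%VF = tens_lift (fun u v => f u v \o h)%VF t.
Proof.
rewrite comp_lfun_suml; apply: eq_bigr => i _; rewrite comp_lfun_suml.
by apply: eq_bigr => j _; rewrite comp_lfunZl.
Qed.

Lemma comp_tens_liftr (X Y Z : vectType F) (f : U -> V -> 'Hom(X, Y))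
    (h : 'Hom(Y, Z)) (t : 'M[F]_(\dim {:U}, \dim {:V})) :
  (h \o tens_lift f t)%VF = tens_lift (fun u v => h \o f u v)%VF t.
Proof.
rewrite comp_lfun_sumr; apply: eq_bigr => i _; rewrite comp_lfun_sumr.
by apply: eq_bigr => j _; rewrite comp_lfunZr.
Qed.

End TensorLift.

Section TensorMaps.
Context (F : fieldType).

Lemma tens_map_comp (U V U' V' U2 V2 : vectType F) (f : 'Hom(U, U')) (g : 'Hom(V, V'))
    (f' : 'Hom(U', U2)) (g' : 'Hom(V', V2)) :
  (tens_map f' g' \o tens_map f g)%VF = tens_map (f' \o f) (g' \o g).
Proof. by apply: tens_eq => u v; rewrite !comp_lfunE !tens_mapE !comp_lfunE. Qed.

Lemma tens_map1 (U V : vectType F) : tens_map (\1 : 'End(U)) (\1 : 'End(V)) = \1%VF.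
Proof. by apply: tens_eq => u v; rewrite tens_mapE !id_lfunE. Qed.

Lemma tens_mapZ (U V U' V' : vectType F) (a b : F) (f : 'Hom(U, U')) (g : 'Hom(V, V')) :
  tens_map (a *: f) (b *: g) = (a * b) *: tens_map f g.
Proof.
apply: tens_eq => u v; rewrite scale_lfunE !tens_mapE !scale_lfunE.
by apply/matrixP=> i j; rewrite !mxE !linearZ /= mulrACA.
Qed.

Lemma tens_map0l (U V U' V' : vectType F) (g : 'Hom(V, V')) :
  tens_map (0 : 'Hom(U, U')) g = 0.
Proof. by rewrite -(scale0r (0 : 'Hom(U, U'))) -[g]scale1r tens_mapZ mul0r scale0r. Qed.

Lemma tens_map0r (U V U' V' : vectType F) (f : 'Hom(U, U')) :
  tens_map f (0 : 'Hom(V, V')) = 0.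
Proof. by rewrite -(scale0r (0 : 'Hom(V, V'))) -[f]scale1r tens_mapZ mulr0 scale0r. Qed.

Lemma tens_map_sum (U V U' V' : vectType F) (I J : finType)
    (f : I -> 'Hom(U, U')) (g : J -> 'Hom(V, V')) :
  tens_map (\sum_i f i) (\sum_j g j) = \sum_i \sum_j tens_map (f i) (g j).
Proof.
apply: tens_eq => u v; rewrite tens_mapE !sum_lfunE.
have E (W : vectType F) (K : finType) (h : K -> W) : \sum_k h k = \sum_k 1 *: h k.
  by apply: eq_bigr => k _; rewrite scale1r.
rewrite E [X in tensv _ X]E tensv_sum; apply: eq_bigr => i _; rewrite sum_lfunE.
by apply: eq_bigr => j _; rewrite tens_mapE mulr1 scale1r.
Qed.

End TensorMaps.

Section HomTensor.
Context (F : fieldType) (U V U' V' : vectType F).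
Context (A : {vspace 'Hom(U, U')}) (B : {vspace 'Hom(V, V')}).

(** The canonical map from Hom(U, U') (x) Hom(V, V') to Hom(U (x) V, U' (x) V'), on A (x) B. *)
Definition hom_tens (t : tens (subvs_of A) (subvs_of B)) :
    'Hom(tens U V, tens U' V') :=
  tens_lift (fun f g => tens_map (vsval f) (vsval g)) t.

HB.instance Definition _ := GRing.Linear.copy hom_tens
  (tens_lift (fun (f : subvs_of A) (g : subvs_of B) => tens_map (vsval f) (vsval g))).

Lemma hom_tens_linear : linear hom_tens.
Proof. by move=> a s t; rewrite linearP. Qed.

Lemma hom_tens0 : hom_tens 0 = 0.
Proof. by rewrite linear0. Qed.

Lemma hom_tens_tensv f g : hom_tens (tensv f g) = tens_map (vsval f) (vsval g).
Proof.
rewrite /hom_tens tens_liftE // => [a f1 f2 g0|a f0 g1 g2];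
  apply: tens_eq => u v; rewrite add_lfunE scale_lfunE !tens_mapE;
  rewrite !linearP add_lfunE scale_lfunE;
  apply/matrixP=> i j; rewrite !mxE !linearP /=.
  by rewrite mulrDl mulrA.
by rewrite mulrDr mulrCA.
Qed.

Lemma hom_tens_lift (X Y : vectType F)
    (h : X -> Y -> 'M[F]_(\dim {: subvs_of A}, \dim {: subvs_of B}))
    (t : 'M[F]_(\dim {:X}, \dim {:Y})) :
  hom_tens (tens_lift h t) = tens_lift (fun x y => hom_tens (h x y)) t.
Proof. exact: (@linear_tens_lift F X Y _ _ hom_tens). Qed.

End HomTensor.

Section SnHomTensor.
Context (F : fieldType) (n : nat).
Implicit Types X Y Z : snModule F n.

Lemma tens_map_sn_hom X Y X' Y' (f : 'Hom(X, Y)) (g : 'Hom(X', Y')) :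
  f \in sn_hom X Y -> g \in sn_hom X' Y' ->
  (tens_map f g : 'Hom(sn_tens X X', sn_tens Y Y')) \in sn_hom (sn_tens X X') (sn_tens Y Y').
Proof.
move=> /sn_homP f_hom /sn_homP g_hom; apply/sn_homP=> s t.
rewrite -[LHS]comp_lfunE -[RHS]comp_lfunE; congr (fun_of_lfun _ t).
apply: tens_eq => u v; rewrite !comp_lfunE /= /tens_act !tens_mapE.
by rewrite f_hom g_hom.
Qed.

Lemma hom_tens_sn_hom X Y X' Y'
    (t : tens (subvs_of (sn_hom X Y)) (subvs_of (sn_hom X' Y'))) :
  (hom_tens t : 'Hom(sn_tens X X', sn_tens Y Y')) \in sn_hom (sn_tens X X') (sn_tens Y Y').
Proof.
apply: memv_suml => i _; apply: memv_suml => j _; rewrite memvZ //.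
by apply: tens_map_sn_hom; exact: subvsP.
Qed.

(** The inner expression on the right is [tens_mod_act]: under [hom_tens] the module action becomes
    composition of maps. *)
Lemma hom_tens_post_comp X Y X' Y'
    (y : tens (subvs_of (sn_hom Y Y)) (subvs_of (sn_hom Y' Y')))
    (t : tens (subvs_of (sn_hom X Y)) (subvs_of (sn_hom X' Y'))) :
  (hom_tens y \o hom_tens t)%VF =
  hom_tens (tens_lift (fun a b =>
    tens_lift (fun f g => tensv (post_comp a f) (post_comp b g)) t) y).
Proof.
rewrite hom_tens_lift [LHS]comp_tens_liftl; apply: eq_tens_lift => a b.
rewrite hom_tens_lift [LHS]comp_tens_liftr; apply: eq_tens_lift => f g.
by rewrite hom_tens_tensv tens_map_comp.
Qed.

End SnHomTensor.

Section TensorDecomposition.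
Context (F : closedFieldType) (n : nat) (M N : snModule F n) (la : partition_of n).

Local Notation homM nu := (subvs_of (sn_hom (specht F nu) M)).
Local Notation homN ga := (subvs_of (sn_hom (specht F ga) N)).
Local Notation homL nu ga := (sn_hom (specht F la) (sn_tens (specht F nu) (specht F ga))).

Definition is_decomposition (X : snModule F n)
    (p : forall nu, 'I_(\dim {: subvs_of (sn_hom (specht F nu) X)}) -> 'Hom(X, specht F nu)) :=
  [/\ forall nu j, p nu j \in sn_hom X (specht F nu),
      forall nu j h, (p nu j \o hom_basis h)%VF = (j == h)%:R *: \1%VF,
      forall nu mu j (f : 'Hom(specht F mu, X)), f \in sn_hom _ _ ->
        nu != mu -> (p nu j \o f)%VF = 0
    & \sum_nu \sum_j (hom_basis j \o p nu j)%VF = \1%VF].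

Lemma decomposition_dual (X : snModule F n)
    (p : forall nu, 'I_(\dim {: subvs_of (sn_hom (specht F nu) X)}) -> 'Hom(X, specht F nu))
    nu j : is_decomposition p -> (p nu j \o hom_basis j)%VF = \1%VF.
Proof. by case=> _ p_dual _ _; rewrite p_dual eqxx scale1r. Qed.

Context (p : forall nu, 'I_(\dim {: homM nu}) -> 'Hom(M, specht F nu)).
Context (q : forall ga, 'I_(\dim {: homN ga}) -> 'Hom(N, specht F ga)).
Hypotheses (pP : is_decomposition p) (qP : is_decomposition q).

Definition kron_basis nu ga (i : 'I_(kronecker F la nu ga)) :
  'Hom(specht F la, sn_tens (specht F nu) (specht F ga)) := (vbasis (homL nu ga))`_i.

Definition assemble
    (T : forall nu ga, 'I_(kronecker F la nu ga) -> tens (homM nu) (homN ga)) :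
    'Hom(specht F la, sn_tens M N) :=
  \sum_nu \sum_ga \sum_i (hom_tens (T nu ga i) \o kron_basis i)%VF.

(** The inverse of [assemble]: for equivariant Y, the dual maps carry Y to a homomorphism from S^la
    to S^nu (x) S^ga, whose i-th coordinate is the (a, b) entry. *)
Definition component (Y : 'Hom(specht F la, sn_tens M N)) nu ga
    (i : 'I_(kronecker F la nu ga)) : tens (homM nu) (homN ga) :=
  \matrix_(a, b) coord (vbasis (homL nu ga)) i (tens_map (p a) (q b) \o Y)%VF.

Lemma kron_basis_sn_hom nu ga i : @kron_basis nu ga i \in homL nu ga.
Proof. by rewrite vbasis_mem // mem_nth // size_tuple. Qed.

Lemma assemble_sn_hom T : assemble T \in sn_hom _ _.
Proof.
apply: memv_suml => nu _; apply: memv_suml => ga _; apply: memv_suml => i _.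
exact: sn_hom_comp (kron_basis_sn_hom i) (hom_tens_sn_hom _).
Qed.

Lemma hom_tensE nu ga (t : tens (homM nu) (homN ga)) :
  hom_tens t = \sum_a \sum_b t a b *: tens_map (hom_basis a) (hom_basis b).
Proof. by []. Qed.

Lemma component_linear nu ga i : linear (fun Y => @component Y nu ga i).
Proof.
move=> c Y Z; apply/matrixP=> a b; rewrite !mxE comp_lfunDr -comp_lfunZr.
by rewrite linearP.
Qed.

Lemma componentK Y : Y \in sn_hom _ _ -> assemble (@component Y) = Y.
Proof.
case: pP qP => [p_hom p_dual p_neq p_sum] [q_hom q_dual q_neq q_sum] Y_hom.
(* The middle term is Y preceded by the identity of M (x) N, expanded through both
   decompositions. *)
transitivity (\sum_(nu : partition_of n) \sum_(ga : partition_of n)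
    \sum_(a < \dim {: homM nu}) \sum_(b < \dim {: homN ga})
    (tens_map (hom_basis a \o p a) (hom_basis b \o q b) \o Y)%VF).
  apply: eq_bigr => nu _; apply: eq_bigr => ga _.
  transitivity (\sum_(i < kronecker F la nu ga) \sum_(a < \dim {: homM nu})
     \sum_(b < \dim {: homN ga}) (component Y i a b *:
     (tens_map (hom_basis a) (hom_basis b) \o kron_basis i)%VF)).
    apply: eq_bigr => i _; rewrite hom_tensE comp_lfun_suml; apply: eq_bigr => a _.
    by rewrite comp_lfun_suml; apply: eq_bigr => b _; rewrite -comp_lfunZl.
  rewrite exchange_big; apply: eq_bigr => a _.
  rewrite exchange_big; apply: eq_bigr => b _.
  rewrite -tens_map_comp -comp_lfunA.
  set X := (tens_map (p a) (q b) \o Y)%VF.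
  have X_hom : X \in homL nu ga
    by exact: sn_hom_comp Y_hom (tens_map_sn_hom (p_hom _ _) (q_hom _ _)).
  rewrite [X in RHS](coord_vbasis X_hom) comp_lfun_sumr.
  by apply: eq_bigr => i _; rewrite mxE -comp_lfunZr.
rewrite -[RHS]comp_lfun1l -tens_map1 -p_sum -q_sum tens_map_sum comp_lfun_suml.
apply: eq_bigr => nu _; rewrite comp_lfun_suml; apply: eq_bigr => ga _.
rewrite tens_map_sum comp_lfun_suml; apply: eq_bigr => a _.
by rewrite comp_lfun_suml.
Qed.

Lemma dual_hom_tens nu ga a b (t : tens (homM nu) (homN ga)) :
  (tens_map (p a) (q b) \o hom_tens t)%VF = t a b *: \1%VF.
Proof.
case: pP qP => [p_hom p_dual p_neq p_sum] [q_hom q_dual q_neq q_sum].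
rewrite hom_tensE comp_lfun_sumr (bigD1 a) //= [X in _ + X]big1 ?addr0 => [|a' ne].
  rewrite comp_lfun_sumr (bigD1 b) //= [X in _ + X]big1 ?addr0 => [|b' ne].
    rewrite -comp_lfunZr tens_map_comp; congr (_ *: _).
    rewrite (decomposition_dual a pP) (decomposition_dual b qP).
    exact: tens_map1.
  by rewrite -comp_lfunZr tens_map_comp q_dual eq_sym (negPf ne) scale0r tens_map0r scaler0.
rewrite comp_lfun_sumr big1 // => b' _.
by rewrite -comp_lfunZr tens_map_comp p_dual eq_sym (negPf ne) scale0r tens_map0l scaler0.
Qed.

Lemma dual_hom_tens_neq nu ga nu' ga' (a : 'I_(\dim {: homM nu}))
    (b : 'I_(\dim {: homN ga})) (t : tens (homM nu') (homN ga')) :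
  (nu != nu') || (ga != ga') -> (tens_map (p a) (q b) \o hom_tens t)%VF = 0.
Proof.
case: pP qP => [p_hom p_dual p_neq p_sum] [q_hom q_dual q_neq q_sum] ne.
rewrite hom_tensE comp_lfun_sumr big1 // => a' _; rewrite comp_lfun_sumr big1 // => b' _.
rewrite -comp_lfunZr tens_map_comp; case/orP: ne => ne.
  by rewrite p_neq ?hom_basisP // tens_map0l scaler0.
by rewrite q_neq ?hom_basisP // tens_map0r scaler0.
Qed.

Lemma assembleK T nu ga i : component (assemble T) i = T nu ga i.
Proof.
apply/matrixP=> a b; rewrite mxE comp_lfun_sumr (bigD1 nu) //=.
rewrite [X in _ + X]big1 ?addr0 => [|nu' ne]; last first.
  rewrite comp_lfun_sumr big1 // => ga' _; rewrite comp_lfun_sumr big1 // => i' _.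
  by rewrite comp_lfunA dual_hom_tens_neq ?comp_lfun0l // eq_sym ne.
rewrite comp_lfun_sumr (bigD1 ga) //= [X in _ + X]big1 ?addr0 => [|ga' ne]; last first.
  rewrite comp_lfun_sumr big1 // => i' _.
  by rewrite comp_lfunA dual_hom_tens_neq ?comp_lfun0l // [ga == _]eq_sym ne orbT.
rewrite comp_lfun_sumr (eq_bigr (fun i' => T nu ga i' a b *: kron_basis i')) => [|i' _].
  exact: (coord_sum_free (fun i' => T nu ga i' a b) i (basis_free (vbasisP (homL nu ga)))).
by rewrite comp_lfunA dual_hom_tens -comp_lfunZl comp_lfun1l.
Qed.

Lemma hom_tens_assemble T (y : tens (subvs_of (sn_hom M M)) (subvs_of (sn_hom N N))) :
  (hom_tens y \o assemble T)%VF = assemble (fun nu ga i =>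
    tens_lift (fun a b =>
      tens_lift (fun f g => tensv (post_comp a f) (post_comp b g)) (T nu ga i)) y).
Proof.
rewrite comp_lfun_sumr; apply: eq_bigr => nu _; rewrite comp_lfun_sumr.
apply: eq_bigr => ga _; rewrite comp_lfun_sumr; apply: eq_bigr => i _.
by rewrite comp_lfunA hom_tens_post_comp.
Qed.

End TensorDecomposition.

(** * Polynomials and the orbit basis *)

Section Monomials.
Context (n m s : nat).
Implicit Types M : monomial n m s.

Lemma mon_ext M M' :
  (forall i j, mon_exp M (mxvec_index i j) = mon_exp M' (mxvec_index i j)) -> M = M'.
Proof.
move=> eqM; apply: mon_exp_inj; apply/mnmP=> v.
by case/mxvec_indexP: v => i j.
Qed.

Lemma mon_degree M : (\sum_(i < n) \sum_(j < m) mon_exp M (mxvec_index i j) = s)%N.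
Proof.
rewrite pair_bigA /= -[RHS](eqP (valP M : mdeg (mon_exp M) == s)) mdegE.
by rewrite [RHS](reindex _ (curry_mxvec_bij n m)); apply: eq_bigr => -[].
Qed.

Lemma mon_exists (e : 'I_n -> 'I_m -> nat) :
  (\sum_(i < n) \sum_(j < m) e i j = s)%N ->
  exists M : monomial n m s, forall i j, mon_exp M (mxvec_index i j) = e i j.
Proof.
move=> sum_e.
(* [block_mon_subproof] reads one half of each block; both halves hold the exponents. *)
pose bs : seq (block m) :=
  [seq [ffun x => match x with inl j => e i j | inr j => e i j end] | i <- enum 'I_n].
have [||M ME] := @block_mon_subproof n m s bs inl.
- by rewrite size_map size_enum_ord.
- rewrite big_map big_enum /= -[RHS]sum_e; apply: eq_bigr => i _.
  by apply: eq_bigr => j _; rewrite ffunE.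
exists M => i j; rewrite ME (nth_map i) ?size_enum_ord //.
by rewrite ffunE nth_ord_enum.
Qed.

Fact pair_is_diagram M M' : is_diagram n s (pair_diagram M M').
Proof.
have sumE f (sM : monomial n m s) :
    (forall i j, color_block M M' i (f j) = mon_exp sM (mxvec_index i j)) ->
    (\sum_(B <- pair_diagram M M') \sum_(j < m) B (f j) = s)%N.
  move=> fE; rewrite (perm_big _ (perm_eq_seq_mset _)) /= big_filter.
  rewrite big_mkcond big_map big_enum /= -[RHS](mon_degree sM).
  apply: eq_bigr => i _; case: ifP => [_|/negbFE/eqP B0].
    by apply: eq_bigr => j _; rewrite fE.
  by rewrite big1 // => j _; rewrite -fE B0 ffunE.
apply/and4P; split.
- rewrite (perm_size (perm_eq_seq_mset _)) size_filter.
  by rewrite (leq_trans (count_size _ _)) // size_map size_enum_ord.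
- by rewrite (perm_mem (perm_eq_seq_mset _)) mem_filter eqxx.
- by apply/eqP/(sumE inl M) => i j; rewrite ffunE.
by apply/eqP/(sumE inr M') => i j; rewrite ffunE.
Qed.

(** Discarding empty blocks loses only their number, which the common length restores. *)
Lemma perm_eq_nonempty (T : eqType) (x0 : T) (s1 s2 : seq T) : size s1 = size s2 ->
  perm_eq [seq x <- s1 | x != x0] [seq x <- s2 | x != x0] -> perm_eq s1 s2.
Proof.
move=> eq_sz eq12; have countE (s0 : seq T) :
    (count_mem x0 s0 = size s0 - size [seq x <- s0 | x != x0])%N.
  by rewrite size_filter -(count_predC (pred1 x0) s0) addnK.
apply/allP=> x _ /=; have [->|ne_x] := eqVneq x x0.
  by rewrite !countE eq_sz (perm_size eq12).
have countE' (s0 : seq T) : count_mem x s0 = count_mem x [seq x <- s0 | x != x0].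
  rewrite count_filter; apply: eq_count => y /=.
  by case: eqP => // ->; rewrite ne_x.
by rewrite countE' [in X in _ == X]countE'; move/seq.permP: eq12 => ->.
Qed.

Lemma pair_diagram_orbit M M' N N' : pair_diagram M M' = pair_diagram N N' ->
  exists g, N = perm_mon g M /\ N' = perm_mon g M'.
Proof.
move/eq_seq_msetP=> eq_f.
have : perm_eq [seq color_block M M' i | i <- enum [set: 'I_n]]
               [seq color_block N N' i | i <- enum [set: 'I_n]].
  rewrite (eq_enum (in_set _)) in eq_f *.
  by apply: perm_eq_nonempty eq_f; rewrite !size_map.
case/value_matching=> h [_ h_inj hE].
have {}h_inj : injective h by move=> i j; apply: h_inj; rewrite inE.
have surj i : exists i0, i = perm h_inj i0.
  by exists ((perm h_inj)^-1%g i); rewrite permKV.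
exists (perm h_inj); split; apply: mon_ext => i j; have [i0 ->] := surj i;
  rewrite perm_monE permE; have /ffunP := hE i0 (in_setT _).
  by move=> /(_ (inl j)); rewrite !ffunE.
by move=> /(_ (inr j)); rewrite !ffunE.
Qed.

End Monomials.

Section OrbitSpan.
Context (F : fieldType) (n m s : nat).
Implicit Types (M : monomial n m s) (a b : alg F n s m).

Lemma alg_mon_coefP a b : (forall M M', mon_coef M M' a = mon_coef M M' b) -> a = b.
Proof.
move=> ab; apply/val_inj/hpoly_lfun_eq => M.
rewrite [LHS]hpoly_sum [RHS]hpoly_sum; apply: eq_bigr => M' _.
by congr (_ *: _); exact: ab.
Qed.

Lemma hcoef_hperm g M (p : hpoly F n m s) :
  hcoef (perm_mon g M) (hperm g p) = hcoef M p.
Proof.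
rewrite {1}(hpoly_sum p) !linear_sum (bigD1 M) //= !linearZ /= hperm_mon hcoef_mon.
rewrite eqxx mulr1 big1 ?addr0 // => N ne_N.
by rewrite !linearZ /= hperm_mon hcoef_mon (inj_eq (@perm_mon_inj _ _ _ g)) (negPf ne_N) mulr0.
Qed.

Lemma mon_coef_perm a g M M' :
  mon_coef (perm_mon g M) (perm_mon g M') a = mon_coef M M' a.
Proof.
rewrite /mon_coef -hperm_mon; have /sn_homP a_hom := subvsP a.
have := a_hom g (mon F M); rewrite /= !lfunE /= => ->.
exact: hcoef_hperm.
Qed.

(** The matrix entries of an equivariant operator are constant on the orbits of pairs of monomials,
    and these are the fibres of [pair_diagram]. The coefficient of O_pi is the entry at any pair
    determining pi. *)
Lemma orbit_span a :
  exists c : diagram n s m -> F, a = \sum_pi c pi *: orbit_op F pi.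
Proof.
have rep (pi : diagram n s m) :
    {MM : monomial n m s * monomial n m s | pair_diagram MM.1 MM.2 == val pi}.
  apply: sigW; have [M [M' MM']] := pair_diagramP pi.
  by exists (M, M'); rewrite MM'.
exists (fun pi => mon_coef (sval (rep pi)).1 (sval (rep pi)).2 a).
apply: alg_mon_coefP => M M'; rewrite linear_sum.
pose pi : diagram n s m := Sub _ (pair_is_diagram M M').
rewrite (bigD1 pi) //= linearZ /= mon_coef_orbit eqxx mulr1 big1 ?addr0 => [|pi' ne].
  have /eqP := svalP (rep pi); rewrite -[val pi]/(pair_diagram M M').
  case: (sval _) => N N' /= /esym/pair_diagram_orbit[g [-> ->]].
  by rewrite mon_coef_perm.
rewrite linearZ /= mon_coef_orbit; case: eqP => [eq_pi|_]; last by rewrite mulr0.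
by case/eqP: ne; apply: val_inj.
Qed.

End OrbitSpan.

(** * Products of monomials in disjoint sets of variables *)

Section Joins.
Local Open Scope nat_scope.
Context (n k l r : nat).
Implicit Types (M : monomial n (k + l) r).

Definition left_degree M : nat :=
  \sum_(i < n) \sum_(j < k) mon_exp M (mxvec_index i (lshift l j)).

Lemma left_degree_le M : left_degree M <= r.
Proof.
rewrite -[X in _ <= X](mon_degree M); apply: leq_sum => i _.
by rewrite [X in _ <= X]big_split_ord leq_addr.
Qed.

Section Degree.
Context (d : nat).
Implicit Types (P : monomial n k d * monomial n l (r - d)).

(* M is the product of P.1, in the variables x_ij with j < k, and of P.2,   *)
(* in the remaining ones.                                                   *)
Definition joins M P : bool :=
  [forall i, [forall j, mon_exp M (mxvec_index i (lshift l j))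
                        == mon_exp P.1 (mxvec_index i j)]
          && [forall j, mon_exp M (mxvec_index i (rshift k j))
                        == mon_exp P.2 (mxvec_index i j)]].

Lemma joinsP M P : reflect
  ((forall i j, mon_exp M (mxvec_index i (lshift l j)) = mon_exp P.1 (mxvec_index i j))
   /\ (forall i j, mon_exp M (mxvec_index i (rshift k j)) = mon_exp P.2 (mxvec_index i j)))
  (joins M P).
Proof.
apply: (iffP forallP) => [h | [h1 h2] i].
  by split=> i j; have /andP[/forallP h1 /forallP h2] := h i; apply/eqP.
by apply/andP; split; apply/forallP=> j; rewrite ?h1 ?h2.
Qed.

Lemma joins_degree M P : joins M P -> left_degree M = d.
Proof.
case/joinsP=> h1 _; rewrite -[RHS](mon_degree P.1).
by apply: eq_bigr => i _; apply: eq_bigr => j _; rewrite h1.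
Qed.

Lemma join_exists P : d <= r -> exists M, forall M', joins M' P = (M' == M).
Proof.
move=> le_d; pose e i (j : 'I_(k + l)) := match split j with
  | inl j1 => mon_exp P.1 (mxvec_index i j1)
  | inr j2 => mon_exp P.2 (mxvec_index i j2) end.
have [|M ME] := @mon_exists n (k + l) r e.
  rewrite -[RHS](subnKC le_d) -{1}(mon_degree P.1) -[X in _ = _ + X](mon_degree P.2).
  rewrite -big_split; apply: eq_bigr => i _; rewrite big_split_ord /=.
  by congr (_ + _); apply: eq_bigr => j _; rewrite /e ?(unsplitK (inl _)) ?(unsplitK (inr _)).
have joinM : joins M P.
  by apply/joinsP; split=> i j; rewrite ME /e ?(unsplitK (inl _)) ?(unsplitK (inr _)).
exists M => M'; apply/idP/eqP=> [|-> //] /joinsP[h1 h2].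
have /joinsP[g1 g2] := joinM; apply: mon_ext => i j; case: (split_ordP j) => j' ->.
  by rewrite h1 g1.
by rewrite h2 g2.
Qed.

Lemma split_exists M : left_degree M = d -> exists P, forall P', joins M P' = (P' == P).
Proof.
move=> deg_M.
have [M1 M1E] := @mon_exists n k d (fun i j => mon_exp M (mxvec_index i (lshift l j))) deg_M.
have [|M2 M2E] := @mon_exists n l (r - d) (fun i j => mon_exp M (mxvec_index i (rshift k j))).
  apply/eqP; rewrite -(eqn_add2l d) subnKC -?{1}deg_M ?left_degree_le //.
  rewrite -[X in _ == X](mon_degree M) -big_split; apply/eqP/eq_bigr => i _.
  by rewrite big_split_ord.
have joinM : joins M (M1, M2).
  by apply/joinsP; split=> i j /=; rewrite ?M1E ?M2E.
exists (M1, M2) => -[M1' M2']; apply/idP/eqP=> [|-> //] /joinsP[/= h1 h2].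
congr (_, _); apply: mon_ext => i j; first by rewrite -h1 M1E.
by rewrite -h2 M2E.
Qed.

Lemma joins_perm g M P :
  joins (perm_mon g M) (perm_mon g P.1, perm_mon g P.2) = joins M P.
Proof.
apply/idP/idP=> /joinsP[/= h1 h2]; apply/joinsP; split=> i j /=.
- by have := h1 (g i) j; rewrite !perm_monE.
- by have := h2 (g i) j; rewrite !perm_monE.
- by rewrite -(permKV g i) !perm_monE h1.
by rewrite -(permKV g i) !perm_monE h2.
Qed.

End Degree.
End Joins.

Lemma sn_tens_actE (F : fieldType) (n : nat) (X Y : snModule F n) g (x : X) (y : Y) :
  sn_act (sn_tens X Y) g (tensv x y) = tensv (sn_act X g x) (sn_act Y g y).
Proof. exact: tens_mapE. Qed.

Lemma polyM_act_mon (F : fieldType) (n m s : nat) g (M : monomial n m s) :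
  sn_act (polyM F n m s) g (mon F M) = mon F (perm_mon g M).
Proof. by rewrite lfunE /= hperm_mon. Qed.

Section Multiplication.
Context (F : fieldType) (n k l r d : nat).

Local Notation Pd := (polyM F n k d).
Local Notation Pe := (polyM F n l (r - d)).
Local Notation Pr := (polyM F n (k + l) r).
Local Notation pairs := (monomial n k d * monomial n l (r - d))%type.

Lemma tens_mon_eq (k' l' d' e' : nat) (W : vectType F)
    (f g : 'Hom(tens (polyM F n k' d') (polyM F n l' e'), W)) :
  (forall M1 M2, f (tensv (mon F M1 : polyM F n k' d') (mon F M2 : polyM F n l' e'))
               = g (tensv (mon F M1 : polyM F n k' d') (mon F M2 : polyM F n l' e'))) ->
  f = g.
Proof.
move=> fg; apply: tens_eq => u v; rewrite (hpoly_sum u) (hpoly_sum v) tensv_sum.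
rewrite !linear_sum; apply: eq_bigr => M1 _; rewrite !linear_sum.
by apply: eq_bigr => M2 _; rewrite !linearZ; congr (_ *: _); exact: fg.
Qed.

(** For d <= r the inner sum has the product monomial as its only term; summing over the relation
    [joins] spares a product function on monomials. *)
Definition mul_fun (p : Pd) (q : Pe) : Pr :=
  \sum_(P : pairs) (hcoef P.1 p * hcoef P.2 q) *: \sum_(M | joins M P) mon F M.

Definition mul_hom : 'Hom(sn_tens Pd Pe, Pr) := linfun (tens_lift mul_fun).

Lemma mul_hom_mon (P : pairs) :
  mul_hom (tensv (mon F P.1 : Pd) (mon F P.2 : Pe)) = \sum_(M | joins M P) mon F M.
Proof.
rewrite lfunE /= tens_liftE => [|a p p' q|a p q q'].
- rewrite /mul_fun (bigD1 P) //= !hcoef_mon !eqxx mulr1 scale1r [X in _ + X]big1 ?addr0 // => P' ne.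
  rewrite !hcoef_mon -natrM mulnb (_ : _ && _ = false) ?scale0r //.
  by apply: contraNF ne => /andP[/eqP e1 /eqP e2];
  rewrite [P]surjective_pairing e1 e2 -surjective_pairing.
- rewrite /mul_fun scaler_sumr -big_split; apply: eq_bigr => P' _ /=.
  by rewrite linearP /= mulrDl scalerDl scalerA mulrA.
rewrite /mul_fun scaler_sumr -big_split; apply: eq_bigr => P' _ /=.
by rewrite linearP /= mulrDr scalerDl scalerA mulrCA.
Qed.

(** Factors each monomial of degree d in the first k columns of variables; the others have no
    factorization and go to 0. *)
Definition comul_fun (p : Pr) : sn_tens Pd Pe :=
  \sum_M hcoef M p *: \sum_(P : pairs | joins M P) tensv (mon F P.1 : Pd) (mon F P.2 : Pe).

Fact comul_fun_is_linear : linear comul_fun.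
Proof.
move=> a p q; rewrite /comul_fun scaler_sumr -big_split /=.
by apply: eq_bigr => M _; rewrite linearP /= scalerDl scalerA.
Qed.
HB.instance Definition _ :=
  GRing.isLinear.Build F Pr (sn_tens Pd Pe) *:%R comul_fun comul_fun_is_linear.

Definition comul_hom : 'Hom(Pr, sn_tens Pd Pe) := linfun comul_fun.

Lemma comul_hom_mon (M : monomial n (k + l) r) :
  comul_hom (mon F M : Pr)
  = \sum_(P : pairs | joins M P) tensv (mon F P.1 : Pd) (mon F P.2 : Pe).
Proof.
rewrite lfunE /= /comul_fun (bigD1 M) //= hcoef_mon eqxx scale1r [X in _ + X]big1 ?addr0 //.
move=> M' ne.
by rewrite hcoef_mon eq_sym (negPf ne) scale0r.
Qed.

Lemma mul_hom_sn_hom : mul_hom \in sn_hom _ _.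
Proof.
apply/sn_homP=> g t; rewrite -[LHS]comp_lfunE -[RHS]comp_lfunE; congr (fun_of_lfun _ t).
apply: tens_mon_eq => M1 M2; rewrite !comp_lfunE.
rewrite sn_tens_actE !polyM_act_mon.
rewrite (mul_hom_mon (M1, M2)) (mul_hom_mon (perm_mon g M1, perm_mon g M2)).
rewrite linear_sum (reindex_inj (@perm_mon_inj _ _ _ g)).
apply: eq_big => M; first by rewrite (joins_perm g M (M1, M2)).
by move=> _; exact/esym/polyM_act_mon.
Qed.

Lemma comul_hom_sn_hom : comul_hom \in sn_hom _ _.
Proof.
apply/sn_homP=> g p; rewrite -[LHS]comp_lfunE -[RHS]comp_lfunE; congr (fun_of_lfun _ p).
apply: hpoly_lfun_eq => M; rewrite !comp_lfunE polyM_act_mon !comul_hom_mon.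
rewrite linear_sum (reindex_inj (h := fun P => (perm_mon g P.1, perm_mon g P.2))) => [|P Q].
  apply: eq_big => P; first by rewrite joins_perm.
  by move=> _; rewrite [RHS]sn_tens_actE !polyM_act_mon.
move=> eqPQ; rewrite [P]surjective_pairing [Q]surjective_pairing; congr (_, _).
  by apply: (@perm_mon_inj _ _ _ g); exact: (congr1 fst eqPQ).
by apply: (@perm_mon_inj _ _ _ g); exact: (congr1 snd eqPQ).
Qed.

Lemma comul_mul : (d <= r)%N -> (comul_hom \o mul_hom)%VF = \1%VF.
Proof.
move=> le_d; apply: tens_mon_eq => M1 M2; rewrite comp_lfunE id_lfunE.
have [M joinM] := join_exists (M1, M2) le_d.
rewrite (mul_hom_mon (M1, M2)) (big_pred1 M) // comul_hom_mon.
have [|P joinP] := @split_exists n k l r d M.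
  by apply: (joins_degree (P := (M1, M2))); rewrite joinM.
rewrite (big_pred1 P) //; have : joins M (M1, M2) by rewrite joinM.
by rewrite joinP => /eqP <-.
Qed.

End Multiplication.

Lemma comul_mul_neq (F : fieldType) (n k l r d d' : nat) : d != d' ->
  (comul_hom F n k l r d' \o mul_hom F n k l r d)%VF = 0.
Proof.
move=> ne_d; apply: tens_mon_eq => M1 M2; rewrite comp_lfunE zero_lfunE.
rewrite (mul_hom_mon F (M1, M2)) linear_sum big1 // => M joinM.
apply: etrans (comul_hom_mon _ _ _) _; rewrite big1 // => P joinP.
by case/eqP: ne_d; rewrite -(joins_degree joinM) (joins_degree joinP).
Qed.

Lemma sum_mul_comul (F : fieldType) (n k l r : nat) :
  \sum_(d < r.+1) (mul_hom F n k l r d \o comul_hom F n k l r d)%VF = \1%VF.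
Proof.
apply: hpoly_lfun_eq => M; rewrite sum_lfunE id_lfunE.
have lt_d : (left_degree M < r.+1)%N by rewrite ltnS left_degree_le.
rewrite (bigD1 (Ordinal lt_d)) //= [X in _ + X]big1 ?addr0 => [|d ne_d].
  rewrite comp_lfunE comul_hom_mon; have [P joinP] := @split_exists n k l r _ M erefl.
  rewrite (big_pred1 P) // mul_hom_mon.
  have [M' joinM'] := join_exists P (left_degree_le M).
  rewrite (big_pred1 M') //; have : joins M P by rewrite joinP.
  by rewrite joinM' => /eqP <-.
rewrite comp_lfunE comul_hom_mon big1 ?linear0 // => P joinP.
by case/eqP: ne_d; apply: val_inj; rewrite /= (joins_degree joinP).
Qed.

(** * Restriction of diagrams to the two sets of entries *)

Section DiagramRestriction.
Local Open Scope nat_scope.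

Lemma nonempty_sum (m : nat) (bs : seq (block m)) (G : block m -> nat) :
  G (empty_block m) = 0 ->
  \sum_(B <- nonempty_blocks bs) G B = \sum_(B <- bs) G B.
Proof.
move=> G0; rewrite (perm_big _ (perm_eq_seq_mset _)) /= big_filter.
rewrite big_mkcond; apply: eq_bigr => B _.
by case: ifP => // /negbFE/eqP ->; rewrite G0.
Qed.

Lemma restrict_block_empty (k m : nat) (h : 'I_k -> 'I_m) :
  restrict_block h (empty_block m) = empty_block k.
Proof. by apply/ffunP=> -[j|j]; rewrite !ffunE. Qed.

Lemma restrict_nonempty_blocks (k m : nat) (h : 'I_k -> 'I_m) (bs : seq (block m)) :
  restrict_diagram h (nonempty_blocks bs)
  = nonempty_blocks [seq restrict_block h B | B <- bs].
Proof.
apply/eq_seq_msetP.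
apply: perm_trans (perm_filter _ (perm_map _ (perm_eq_seq_mset _))) _.
suff -> : [seq B <- [seq restrict_block h B | B <- bs & B != empty_block m] | B != empty_block k]
   = [seq B <- [seq restrict_block h B | B <- bs] | B != empty_block k] by [].
elim: bs => //= B bs IHbs; case: eqP => [->|_] /=; last by rewrite IHbs.
by rewrite restrict_block_empty eqxx.
Qed.

Lemma restrict_pair_diagram (n k m s d : nat) (h : 'I_k -> 'I_m)
    (M M' : monomial n m s) (N N' : monomial n k d) :
  (forall i j, mon_exp M (mxvec_index i (h j)) = mon_exp N (mxvec_index i j)) ->
  (forall i j, mon_exp M' (mxvec_index i (h j)) = mon_exp N' (mxvec_index i j)) ->
  restrict_diagram h (pair_diagram M M') = pair_diagram N N'.
Proof.
move=> hN hN'; rewrite restrict_nonempty_blocks; congr nonempty_blocks.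
rewrite -map_comp; apply: eq_map => i; apply/ffunP=> -[j|j];
by rewrite /= !ffunE ?hN ?hN'.
Qed.

(** The d unbarred and d barred entries of pi count the left degrees of M and M'. Hence an embedded
    element of degree d preserves the d-th summand and kills the others. *)
Lemma restrict_left_degree (n k l r d : nat) (pi : diagram n d k)
    (M M' : monomial n (k + l) r) :
  restrict_diagram (@lshift k l) (pair_diagram M M') = val pi ->
  left_degree M = d /\ left_degree M' = d.
Proof.
rewrite restrict_nonempty_blocks => eq_pi.
have /and4P[_ _ /eqP dM /eqP dM'] := valP pi.
split; [rewrite -[RHS]dM | rewrite -[RHS]dM']; rewrite -eq_pi nonempty_sum;
  try (by rewrite big1 // => j _; rewrite ffunE); rewrite 2!big_map big_enum /=;
  by apply: eq_bigr => i _; apply: eq_bigr => j _; rewrite !ffunE.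
Qed.

End DiagramRestriction.

Lemma tensv_sum_cond (F : fieldType) (U V : vectType F) (I J : finType)
    (P : pred I) (Q : pred J) (u : I -> U) (v : J -> V) :
  tensv (\sum_(i | P i) u i) (\sum_(j | Q j) v j)
  = \sum_(p : I * J | P p.1 && Q p.2) tensv (u p.1) (v p.2).
Proof.
rewrite -(pair_big P Q (fun i j => tensv (u i) (v j))) /=.
apply/matrixP=> x y; rewrite mxE summxE !linear_sum mulr_suml /=.
apply: eq_bigr => i _; rewrite summxE mulr_sumr; apply: eq_bigr => j _.
by rewrite !mxE.
Qed.

(** * Embedded operators acting on products of polynomials *)

Section EmbedMul.
Context (F : fieldType) (n k l r : nat).

Lemma embed_orbits_mon (d : nat) (pi : diagram n d k) (ga : diagram n (r - d) l)
    (M : monomial n (k + l) r) :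
  vsval (embed_orbits F pi ga) (mon F M) =
  \sum_(M' | (restrict_diagram (@lshift k l) (pair_diagram M M') == val pi)
          && (restrict_diagram (@rshift k l) (pair_diagram M M') == val ga)) mon F M'.
Proof.
rewrite /embed_orbits linear_sum sum_lfunE.
pose D M' : diagram n r (k + l) := Sub _ (pair_is_diagram M M').
rewrite [RHS](partition_big D (fun tau : diagram n r (k + l) =>
          (restrict_diagram (@lshift k l) (val tau) == val pi)
       && (restrict_diagram (@rshift k l) (val tau) == val ga))) //=.
apply: eq_bigr => tau tauP; rewrite lfunE /= orbit_fun_mon.
apply: eq_bigl => M'.
have -> : (D M' == tau) = (pair_diagram M M' == val tau) by [].
by case: eqP => [eq_tau|_]; rewrite ?andbF // eq_tau tauP.
Qed.

(** Restricting the diagram of two products gives the diagrams of their factors. So both sides send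
    the tensor of N1 and N2 to the sum of the products Q1 Q2 with (N1, Q1) determining pi and (N2,
    Q2) determining ga. *)
Lemma embed_orbits_mul (d : nat) (pi : diagram n d k) (ga : diagram n (r - d) l) :
  (d <= r)%N ->
  (vsval (embed_orbits F pi ga) \o mul_hom F n k l r d)%VF =
  (mul_hom F n k l r d \o tens_map (vsval (orbit_op F pi)) (vsval (orbit_op F ga)))%VF.
Proof.
move=> le_d; apply: tens_mon_eq => N1 N2; rewrite !comp_lfunE tens_mapE.
have [M joinM] := join_exists (N1, N2) le_d.
have joinMN : joins M (N1, N2) by rewrite joinM.
rewrite (mul_hom_mon F (N1, N2)) (big_pred1 M) // embed_orbits_mon.
rewrite [X in tensv X _]lfunE [X in tensv _ X]lfunE /= !orbit_fun_mon.
rewrite tensv_sum_cond linear_sum.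
pose cond (P : monomial n k d * monomial n l (r - d)) :=
  (pair_diagram N1 P.1 == val pi) && (pair_diagram N2 P.2 == val ga).
transitivity (\sum_(P | cond P) \sum_(M' | joins M' P) mon F M' : hpoly F n (k + l) r);
  last by apply: eq_bigr => P _; rewrite -mul_hom_mon.
rewrite (exchange_big_dep predT) //= big_mkcond; apply: eq_bigr => M' _.
(* A monomial of another left degree occurs on neither side. *)
have [deg_d|deg_nd] := eqVneq (left_degree M') d; last first.
  rewrite big1 => [|P /andP[_ /joins_degree deg_d]]; last by rewrite deg_d eqxx in deg_nd.
  case: ifP => // /andP[/eqP/restrict_left_degree[_ deg_d] _].
  by rewrite deg_d eqxx in deg_nd.
have [Q joinQ] := split_exists deg_d.
have /joinsP[M'1 M'2] : joins M' Q by rewrite joinQ.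
have /joinsP[M1 M2] := joinMN.
rewrite (restrict_pair_diagram M1 M'1) (restrict_pair_diagram M2 M'2) -/(cond Q).
rewrite (eq_bigl (fun P => cond Q && (P == Q))) => [|P].
  by case: (cond Q); rewrite /= ?big_pred1_eq ?big_pred0_eq.
by rewrite joinQ andbC; have [->|_] := eqVneq P Q; [rewrite !andbT | rewrite !andbF].
Qed.

Lemma embed_orbits_mul_neq (d d' : nat) (pi : diagram n d k) (ga : diagram n (r - d) l) :
  d != d' -> (vsval (embed_orbits F pi ga) \o mul_hom F n k l r d')%VF = 0.
Proof.
move=> ne_d; apply: tens_mon_eq => N1 N2; rewrite comp_lfunE zero_lfunE.
rewrite (mul_hom_mon F (N1, N2)) linear_sum big1 // => M /joins_degree deg_M.
apply: etrans (embed_orbits_mon _ _ _) _; rewrite big1 // => M' /andP[/eqP].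
by case/restrict_left_degree=> deg_M' _; rewrite -deg_M' deg_M eqxx in ne_d.
Qed.

(** Reduces linear statements about [embed] to tensors of orbit operators, where [embed_orbit]
    computes it. *)
Lemma alg_tens_ind (d : nat) (P : tens (alg F n d k) (alg F n (r - d) l) -> Prop) :
  P 0 -> (forall a s t, P s -> P t -> P (a *: s + t)) ->
  (forall pi ga, P (tensv (orbit_op F pi) (orbit_op F ga))) -> forall y, P y.
Proof.
move=> P0 PD PO; have PA s t : P s -> P t -> P (s + t).
  by move=> Ps Pt; rewrite -[s]scale1r; exact: PD.
apply: tens_ind => // a b.
have [c ->] := orbit_span a; have [c' ->] := orbit_span b; rewrite tensv_sum.
elim/big_ind: _ => // pi _; elim/big_ind: _ => // ga _.
by rewrite -[_ *: _]addr0; exact: PD.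
Qed.

Lemma embed_linear (d : nat) : linear (@embed F n r k l d).
Proof. by move=> a s t; rewrite /embed linearP. Qed.

Lemma embed0 (d : nat) : @embed F n r k l d 0 = 0.
Proof. by rewrite /embed linear0. Qed.

Lemma embed_mul (d : nat) (y : tens (alg F n d k) (alg F n (r - d) l)) :
  (d <= r)%N ->
  (vsval (embed y) \o mul_hom F n k l r d)%VF = (mul_hom F n k l r d \o hom_tens y)%VF.
Proof.
move=> le_d; elim/alg_tens_ind: y => [|a s t IHs IHt|pi ga].
- by rewrite embed0 hom_tens0 linear0 comp_lfun0l comp_lfun0r.
- rewrite embed_linear hom_tens_linear linearP comp_lfunDl comp_lfunDr -comp_lfunZl -comp_lfunZr.
  by rewrite IHs IHt.
by rewrite embed_orbit hom_tens_tensv embed_orbits_mul.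
Qed.

Lemma embed_mul_neq (d d' : nat) (y : tens (alg F n d k) (alg F n (r - d) l)) :
  d != d' -> (vsval (embed y) \o mul_hom F n k l r d')%VF = 0.
Proof.
move=> ne_d; elim/alg_tens_ind: y => [|a s t IHs IHt|pi ga].
- by rewrite embed0 linear0 comp_lfun0l.
- by rewrite embed_linear linearP comp_lfunDl -comp_lfunZl IHs IHt scaler0 addr0.
by rewrite embed_orbit embed_orbits_mul_neq.
Qed.

End EmbedMul.

(** * The restriction *)

Section Restriction.
Context (F : closedFieldType) (n r k l : nat) (la : partition_of n).

Local Notation Pk d := (polyM F n k d).
Local Notation Pl d := (polyM F n l (r - d)).
Local Notation mul d := (mul_hom F n k l r d).
Local Notation comul d := (comul_hom F n k l r d).
Local Notation W := (kron_sum F r k l la).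

Context (p : forall (d : 'I_r.+1) (nu : partition_of n),
  'I_(\dim {: algW F d k nu}) -> 'Hom(Pk d, specht F nu)).
Context (q : forall (d : 'I_r.+1) (ga : partition_of n),
  'I_(\dim {: algW F (r - d) l ga}) -> 'Hom(Pl d, specht F ga)).
Hypotheses (pP : forall d : 'I_r.+1, @is_decomposition F n (Pk d) (@p d)).
Hypotheses (qP : forall d : 'I_r.+1, @is_decomposition F n (Pl d) (@q d)).

Definition summand_hom (t : W) (d : 'I_r.+1) :
    'Hom(specht F la, sn_tens (Pk d) (Pl d)) :=
  @assemble F n (Pk d) (Pl d) la (fun nu ga i => t d nu ga i).

Definition assembled_hom (t : W) : 'Hom(specht F la, polyM F n (k + l) r) :=
  \sum_(d < r.+1) (mul d \o summand_hom t d)%VF.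

Fact assembled_hom_sn_hom t : assembled_hom t \in sn_hom (specht F la) (polyM F n (k + l) r).
Proof.
apply: memv_suml => d _.
exact: sn_hom_comp (assemble_sn_hom _) (mul_hom_sn_hom _ _ _ _ _ _).
Qed.

Definition kron_merge (t : W) : algW F r (k + l) la := Subvs (assembled_hom_sn_hom t).

Definition kron_split (w : algW F r (k + l) la) : W :=
  [ffun d : 'I_r.+1 => [ffun nu => [ffun ga => [ffun i =>
     @component F n (Pk d) (Pl d) la (@p d) (@q d) (comul d \o vsval w)%VF nu ga i]]]].

Fact kron_split_is_linear : linear kron_split.
Proof.
move=> a v w; apply/ffunP=> d; rewrite !ffunE; apply/ffunP=> nu; rewrite !ffunE.
apply/ffunP=> ga; rewrite !ffunE; apply/ffunP=> i; rewrite !ffunE.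
rewrite linearP comp_lfunDr -comp_lfunZr.
exact: (component_linear (@p d) (@q d)).
Qed.
HB.instance Definition _ := GRing.isLinear.Build F _ _ *:%R kron_split kron_split_is_linear.

Lemma kron_splitK : cancel kron_split kron_merge.
Proof.
move=> w; apply: val_inj; rewrite /= /assembled_hom -[RHS]comp_lfun1l -(sum_mul_comul F n k l r).
rewrite comp_lfun_suml; apply: eq_bigr => d _; rewrite -comp_lfunA; congr (_ \o _)%VF.
rewrite -[RHS](componentK (pP d) (qP d)); last first.
  exact: sn_hom_comp (subvsP w) (comul_hom_sn_hom _ _ _ _ _ _).
apply: eq_bigr => nu _; apply: eq_bigr => ga _; apply: eq_bigr => i _.
by rewrite !ffunE.
Qed.

Lemma kron_mergeK : cancel kron_merge kron_split.
Proof.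
move=> t; apply/ffunP=> d; rewrite ffunE; apply/ffunP=> nu; rewrite ffunE.
apply/ffunP=> ga; rewrite ffunE; apply/ffunP=> i; rewrite ffunE.
rewrite /= /assembled_hom comp_lfun_sumr (bigD1 d) //= big1 ?addr0 => [|d' ne]; last first.
  by rewrite comp_lfunA comul_mul_neq ?comp_lfun0l // (inj_eq val_inj).
rewrite comp_lfunA comul_mul ?comp_lfun1l; last by rewrite -ltnS.
exact: (assembleK (pP d) (qP d)).
Qed.

Lemma summand_hom_kron_act (x : sum_alg F n r k l) t (d : 'I_r.+1) :
  summand_hom (kron_act x t) d = (hom_tens (x d) \o summand_hom t d)%VF.
Proof.
rewrite [RHS](@hom_tens_assemble F n (Pk d) (Pl d) la (fun nu ga i => t d nu ga i) (x d)).
apply: eq_bigr => nu _; apply: eq_bigr => ga _; apply: eq_bigr => i _.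
by rewrite /kron_act !ffunE.
Qed.

Lemma embed_mul_summand (x : sum_alg F n r k l) t (d d' : 'I_r.+1) :
  (vsval (embed (x d)) \o (mul d' \o summand_hom t d'))%VF
  = if d' == d then (mul d \o (hom_tens (x d) \o summand_hom t d))%VF else 0.
Proof.
rewrite [LHS]comp_lfunA; have [->|ne_d] := eqVneq d' d.
  by rewrite (embed_mul (x d) (leq_ord d)) [RHS]comp_lfunA.
by rewrite (embed_mul_neq (d' := d') (x d)) ?comp_lfun0l // eq_sym.
Qed.

(** In the double sum over components of x and summands of t, only the diagonal terms survive, by
    [embed_mul_summand]. *)
Lemma kron_merge_act (x : sum_alg F n r k l) t :
  kron_merge (kron_act x t) = res_act x (kron_merge t).
Proof.
apply: val_inj; rewrite /= /sum_embed linear_sum comp_lfun_suml; apply: eq_bigr => d _.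
rewrite summand_hom_kron_act [RHS]comp_lfun_sumr.
rewrite (eq_bigr _ (fun d' _ => embed_mul_summand x t d d')).
by rewrite -big_mkcond big_pred1_eq.
Qed.

Lemma restriction_iso : module_iso (A := sum_alg F n r k l)
  (@res_act F n r k l la) (@kron_act F n r k l la).
Proof.
exists kron_split; first by exists kron_merge; [exact: kron_splitK | exact: kron_mergeK].
(* Equivariance is known for the inverse [kron_merge] and is transferred along the bijection. *)
move=> x w; apply: etrans (kron_mergeK _); congr kron_split.
by rewrite kron_merge_act kron_splitK.
Qed.

End Restriction.

Lemma restriction_decomposition (F : closedFieldType) (n r k l : nat) (la : partition_of n) :
  [pchar F] =i pred0 ->
  module_iso (A := sum_alg F n r k l) (@res_act F n r k l la) (@kron_act F n r k l la).
Proof.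
move=> charF.
have [p pP] := fin_all_exists (fun d : 'I_r.+1 => hom_decomposition charF (polyM F n k d)).
have [q qP] := fin_all_exists (fun d : 'I_r.+1 => hom_decomposition charF (polyM F n l (r - d))).
exact: restriction_iso pP qP.
Qed.

Theorem theorem5p10 (R : realType) (r k l n : nat) (la : partition_of n)
    (r_gt0 : (0 < r)%N) (k_gt0 : (0 < k)%N) (l_gt0 : (0 < l)%N)
    (n_gt0 : (0 < n)%N) :
  module_iso (A := sum_alg R[i] n r k l)
    (V := algW R[i] r (k + l) la)
    (W := kron_sum R[i] r k l la)
    (@res_act R[i] n r k l la)
    (@kron_act R[i] n r k l la).
Proof.
exact: restriction_decomposition (Num.Theory.pchar_num R[i]).
Qed.
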